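(* $h_{2\times 4}> 78.32$.
   Context: A $2\times 4$ block is a subset of $\mathbb{R}^3$ of the form $[x,x+2]\times[y,y+4]\times[z,z+1]$ or $[x,x+4]\times[y,y+2]\times[z,z+1]$ with $x,y,z\in\mathbb{Z}$. A building is a finite set of blocks with pairwise disjoint interiors. Two blocks of a building are attached if their $z$-coordinates differ by exactly $1$ and their projections to the $xy$-plane overlap in a set with nonempty interior (i.e. at least one stud of the lower block is inserted into the upper block). A building is contiguous if the graph on its blocks given by attachment is connected. Two buildings are identified if one is mapped onto the other by a composition of translations of $\mathbb{R}^3$ and rotations about vertical axes (rotations in the $xy$-plane, by multiples of $90^\circ$). $T_{2\times 4}(n)$ denotes the number of contiguous buildings consisting of exactly $n$ such blocks, counted up to this identification. The entropy is $s_{2\times 4}=\lim_{n\to\infty}\frac{\log(T_{2\times 4}(n))}{n}$ (this limit exists and is finite), and $h_{2\times 4}=\exp(s_{2\times 4})$. *)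

(* Defs.v *)
From HB Require Import structures.
From mathcomp Require Import all_boot all_order all_algebra finmap.
From mathcomp Require Import all_classical all_reals all_analysis.

Set Implicit Arguments.
Unset Strict Implicit.
Unset Printing Implicit Defensive.

Import Order.TTheory GRing.Theory Num.Theory.
Import numFieldNormedType.Exports.

Local Open Scope classical_set_scope.
Local Open Scope ring_scope.

(* (d, x, y, z) has minimal corner (x, y, z); it measures 2 along the x-axis
   and 4 along the y-axis if d = false, and 4 by 2 if d = true.  Distinct codes
   have distinct bodies, so a set of codes is the same thing as a set of
   blocks of R^3. *)
Definition block : Type := (bool * int * int * int)%type.

Definition block_rotated (b : block) : bool := b.1.1.1.
Definition block_x (b : block) : int := b.1.1.2.
Definition block_y (b : block) : int := b.1.2.
Definition block_z (b : block) : int := b.2.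
Definition block_lx (b : block) : int := if block_rotated b then 4 else 2.
Definition block_ly (b : block) : int := if block_rotated b then 2 else 4.

Section Geometry.
Variable R : realType.

(* The xy-plane is R * R and R^3 is (R * R) * R, so p.1 is the projection of p
   to the xy-plane. *)
Definition body (b : block) : set (R * R * R) :=
  `[(block_x b)%:~R, (block_x b + block_lx b)%:~R]
  `*` `[(block_y b)%:~R, (block_y b + block_ly b)%:~R]
  `*` `[(block_z b)%:~R, (block_z b + 1)%:~R].

Definition is_building (B : {fset block}) : Prop :=
  forall b c, b \in B -> c \in B -> b != c ->
    interior (body b) `&` interior (body c) = set0.

Definition attached (b c : block) : Prop :=
  `|block_z b - block_z c| = 1 /\
  interior ((fst @` body b) `&` (fst @` body c)) !=set0.

Definition contiguous (B : {fset block}) : Prop :=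
  forall b c : B,
    connect (fun u v : B => `[< attached (val u) (val v) >]) b c.

Definition translation (v p : R * R * R) : R * R * R := p + v.

(* Rotation by 90 degrees about the vertical axis through a. *)
Definition quarter_turn (a : R * R) (p : R * R * R) : R * R * R :=
  (a.1 - (p.1.2 - a.2), a.2 + (p.1.1 - a.1), p.2).

Inductive motion : (R * R * R -> R * R * R) -> Prop :=
| motion_translation v : motion (translation v)
| motion_rotation a k : motion (iter k (quarter_turn a))
| motion_comp f g : motion f -> motion g -> motion (f \o g).

(* The motion has to match the blocks, not only their union: different buildings
   can fill the same subset of R^3. *)
Definition identified (B C : {fset block}) : Prop :=
  exists2 f, motion f &
    [set f @` body b | b in [set` B]] = [set body c | c in [set` C]].

Definition contiguous_buildings (n : nat) : set {fset block} :=
  [set B | [/\ is_building B, contiguous B & #|` B| = n]].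

Definition building_classes (n : nat) : set (set {fset block}) :=
  [set [set C | contiguous_buildings n C /\ identified B C]
     | B in contiguous_buildings n].

(* fset_set is only meaningful on finite sets; there are finitely many classes
   for every n. *)
Definition T24 (n : nat) : nat := #|` fset_set (building_classes n)|.

(* The sequence converges; limn would be an arbitrary value otherwise. *)
Definition s24 : R := limn (fun n : nat => ln (T24 n)%:R / n%:R : R).

Definition h24 : R := expR s24.

End Geometry.

(* Main.v *)
From Stdlib Require Import ZArith.
Require Import Defs.
From mathcomp Require Import all_boot all_order all_algebra finmap.
From mathcomp Require Import zify ring lra ssrZ.
From mathcomp Require Import all_classical all_reals all_analysis.

(* Stacking one building on top of another and cutting the result after its
   lowest blocks shows that T24 is supermultiplicative, and encoding a building
   by a walk through its blocks bounds T24 exponentially; by Fekete's lemma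
   ln (T24 n) / n converges to its supremum.  It is thus enough to exhibit
   about 78.33^n buildings with n blocks, up to a constant factor.

   We count buildings made of layers of at most three blocks over one bottom
   block, built upwards layer by layer.  The top layer carries one of three
   states: a single block, a pair already connected to the building, or a pair
   one block of which is pending, i.e. not yet connected to the rest (a pending
   block has to be caught by a later layer).  Distinct choices of
   layers give distinct sets of blocks, so no decoding is needed.  If V is a
   positive function of the state such that, for every state,
       V(state) <= sum over the next layers D of (100/7833)^|D| V(next state),
   then the number of ways to add n blocks is at least a constant times
   V(state) (7833/100)^n.  A table for V is verified by computation, for one
   representative of each pair up to symmetry. *)

Set Implicit Arguments.
Unset Strict Implicit.
Unset Printing Implicit Defensive.

Import Order.TTheory GRing.Theory Num.Theory.
Import numFieldNormedType.Exports.

(** * The numerical certificate *)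

(** Every count is a lower bound, so any family of layers may be dropped; this freedom keeps the set
    of states small. A layer of three blocks is remembered through two of them only. The value of a
    pending pair vanishes as soon as its blocks are far apart, so the sum over the infinitely many
    positions of a pending block reduces to a finite window. Layers with a pending block are never
    enumerated: the total value of all its positions is known, and the excluded positions are
    subtracted from it, which leaves a sum over pairs. Identification by motions costs only a
    bounded factor, because all towers stand on one common bottom block: a motion between two of
    them must fix that block, so at most four towers lie in one class. The value 7833 leaves slack
    above the stated bound; the passage to the limit gives a weak inequality only, and the slack
    makes it strict. *)

(* A block of a layer is given by its orientation and its centre: whether two
   blocks overlap then depends on their orientations and on the absolute
   differences p, q of the coordinates only.  In the computations the centres
   are natural numbers. *)
Definition grid_block := (bool * nat * nat)%type.

Fixpoint ndist (m n : nat) : nat :=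
  match m, n with
  | m'.+1, n'.+1 => ndist m' n'
  | 0, _ => n
  | _, 0 => m
  end.

Lemma ndistE m n : ndist m n = ((m - n) + (n - m))%N.
Proof. by elim: m n => [|m IH] [|n] //=; rewrite ?IH ?subSS ?subn0 ?addn0. Qed.

Arguments ndist : simpl never.

(** The half-lengths are 1 and 2. Interiors of perpendicular blocks meet when both differences of
    centres are below 3; for parallel blocks the bounds are 4 along the long side and 2 along the
    short one. *)
Definition overlap_at (dir dir' : bool) (p q : nat) : bool :=
  if xorb dir dir' then Nat.leb p 2 && Nat.leb q 2
  else if dir then Nat.leb p 3 && Nat.leb q 1 else Nat.leb p 1 && Nat.leb q 3.

(* Equal for pairs of blocks that are equivalent under the symmetries of the plane. *)
Definition pair_key (dir dir' : bool) (p q : nat) : bool * nat * nat :=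
  if xorb dir dir' then if Nat.leb p q then (true, p, q) else (true, q, p)
  else if dir then (false, q, p) else (false, p, q).

Definition pair_table (T F : seq (seq Z)) (dflt : Z) (dir dir' : bool) (p q : nat) : Z :=
  let '(m, p, q) := pair_key dir dir' p q in nth dflt (nth [::] (if m then T else F) p) q.

Section Certificate.
Local Open Scope Z_scope.

Definition mu : Z := 7833.

Definition cent : Z := 100.

(* The values of V: a numerical Perron eigenvector of the transition matrix,
   rounded down.  The lists are indexed by the second and third component of
   the key.  A pair too far apart for the tables is worth as much as one of its
   blocks if it is connected, and nothing if one block is pending. *)
Definition Vsingle : Z := 1000.

Definition Vjoined := pair_table
 [:: [:: 1000; 1000; 1000; 2086; 2399; 2520; 2608];
     [:: 1000; 1000; 1000; 2098; 2411; 2530; 2615];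
     [:: 1000; 1000; 1000; 2275; 2517; 2594; 2635];
     [:: 1000; 1000; 1000; 2456; 2625; 2656; 2649];
     [:: 1000; 1000; 1000; 1000; 2716; 2699; 2646];
     [:: 1000; 1000; 1000; 1000; 1000; 2673; 2617];
     [:: 1000; 1000; 1000; 1000; 1000; 1000; 2567]]
 [:: [:: 1000; 1000; 1000; 1000; 2069; 2362; 2455];
     [:: 1000; 1000; 1000; 1000; 2224; 2449; 2505];
     [:: 1769; 1918; 2081; 2246; 2407; 2559; 2572];
     [:: 2241; 2326; 2424; 2521; 2609; 2681; 2645];
     [:: 2496; 2544; 2601; 2653; 2692; 2711; 2660];
     [:: 2708; 2715; 2728; 2734; 2725; 2694; 2638];
     [:: 2668; 2671; 2676; 2673; 2657; 2626; 2577]]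
 1000.

Definition Vpending := pair_table
 [:: [:: 0; 0; 0; 469; 233; 138; 0];
     [:: 0; 0; 0; 480; 237; 140; 0];
     [:: 0; 0; 0; 366; 172; 102; 0];
     [:: 0; 0; 0; 246; 105; 63; 0]]
 [:: [:: 0; 0; 0; 0; 491; 237; 137];
     [:: 0; 0; 0; 0; 366; 168; 98];
     [:: 656; 559; 466; 363; 244; 102; 61];
     [:: 356; 293; 237; 176; 108];
     [:: 215; 178; 143; 106; 65]] 0.

(* The sum of Vpending over all positions of the pending block. *)
Definition Vpending_total : Z := 36780.

(* An upper bound on the sum of Vpending over the positions of the pending block
   that overlap the other block of the pair. *)
Definition Vpending_over := pair_table
 [:: [:: 0; 0; 0; 9910; 9263; 5678; 3691];
     [:: 0; 0; 0; 8550; 8239; 5024; 3329];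
     [:: 0; 0; 0; 8135; 7344; 4289; 2660];
     [:: 0; 0; 0; 6690; 5622; 3047; 1655];
     [:: 0; 0; 0; 0; 4150; 2057; 896];
     [:: 0; 0; 0; 0; 0; 897; 339];
     [:: 0; 0; 0; 0; 0; 0; 128]]
 [:: [:: 0; 0; 0; 0; 5963; 5963; 3802];
     [:: 0; 0; 0; 0; 7266; 6341; 3834];
     [:: 8412; 9719; 9316; 8364; 6635; 5245; 2876];
     [:: 10103; 10495; 9408; 7904; 5820; 4150; 2044];
     [:: 6671; 6702; 5742; 4596; 3168; 2057; 897];
     [:: 4903; 4636; 3741; 2786; 1714; 896; 339];
     [:: 1673; 1567; 1190; 819; 442; 168; 0]] Vpending_total.

Definition grid_app {T} (f : bool -> bool -> nat -> nat -> T) (b c : grid_block) : T :=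
  let '(dir, x, y) := b in let '(dir', x', y') := c in f dir dir' (ndist x x') (ndist y y').

(** Overlap reaches at most 3 in each coordinate, and the pairs to be checked have coordinates from
    6 to 12, so the range from 3 to 15 contains every block touching them. *)
Definition grid_box : seq grid_block :=
  [seq (ox, y) | ox <- [seq (dir, x) | dir <- [:: false; true], x <- iota 3 13], y <- iota 3 13].

Definition sumZ (T : Type) (f : T -> Z) (s : seq T) := foldr (fun x z => Z.add (f x) z) 0 s.

(* U lists the positions touching the current state, ok those connecting
   everything below, cross the pairs that leave one component pending.  The
   layers counted are {d} and {d, h} with d ok; {d, e} with d or e ok; {d, e, h}
   likewise; and {d, e} crossing; where h is a pending block outside U attached
   later together with d.  All weights are multiplied by mu^3 / cent. *)
Section Total.
Variables (B : Type) (app : forall T, (bool -> bool -> nat -> nat -> T) -> B -> B -> T).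
Variables (U : seq B) (ok : B -> bool) (cross : B -> B -> bool).

Definition pending_weight d := Vpending_total - sumZ (app Vpending d) U.

Definition pair_weight (d : B) (okd : bool) (r : Z) (e : B) : Z :=
  app (fun dir dir' p q =>
    if overlap_at dir dir' p q then 0 else
    if okd || ok e then
      (* [r] excludes the positions in [U]; those overlapping the second block are now subtracted
         too. [Vpending_over] may count a position of [U] again, so the difference can be negative,
         and then no triple is counted. *)
      mu * Vjoined dir dir' p q + cent * Z.max 0 (r - Vpending_over dir dir' p q)
    else if cross d e then mu * Vpending dir dir' p q else 0) d e.

Fixpoint total (s : seq B) : Z :=
  if s is d :: s' then
    let r := pending_weight d in let okd := ok d in
    (if okd then mu * (mu * Vsingle) + cent * (mu * r) else 0) +
    (cent * sumZ (pair_weight d okd r) s' + total s')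
  else 0.
End Total.

Definition base_block : grid_block := (false, 6%N, 6%N).

Definition touching_grid (S : seq grid_block) :=
  [seq b <- grid_box | has (fun c => grid_app overlap_at c b) S].

Definition total_joined (S : seq grid_block) :=
  let U := touching_grid S in
  total (@grid_app) U (fun _ => true) (fun _ _ => false) U.

(** A block touching both blocks of the pair connects everything. Two blocks touching one each
    continue the two components separately, and the new pair is pending again. *)
Definition total_pending (c h : grid_block) :=
  let U := touching_grid [:: c; h] in
  total (@grid_app) U (fun d => grid_app overlap_at c d && grid_app overlap_at h d)
    (fun d e => xorb (grid_app overlap_at c d) (grid_app overlap_at c e)) U.

Definition mu_cube := mu * (mu * mu).

Definition pair_grid : seq grid_block :=
  [seq (ox, y) | ox <- [seq (dir, x) | dir <- [:: false; true], x <- iota 6 7], y <- iota 6 7].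

(** Transposition exchanges [p] and [q] for a perpendicular pair, so rotated blocks [r] with [y < x]
    are skipped. *)
Definition check_joined (r : grid_block) : bool :=
  grid_app overlap_at base_block r || (let '(dir, x, y) := r in dir && Nat.ltb y x)
  || Z.leb (mu_cube * grid_app Vjoined base_block r) (cent * total_joined [:: base_block; r]).

Definition check_pending (r : grid_block) : bool :=
  Z.eqb (grid_app Vpending base_block r) 0
  || (let '(dir, x, y) := r in dir && Nat.ltb y x)
  || Z.leb (mu_cube * grid_app Vpending base_block r) (cent * total_pending base_block r).

Definition grid_window : seq grid_block :=
  [seq (ox, y) | ox <- [seq (dir, x) | dir <- [:: false; true], x <- iota 0 13], y <- iota 0 13].

(** The window reaches 6 in each direction from the base block, as far as the tables do; outside it
    [Vpending] is zero. *)
Definition check_window (dir : bool) : bool :=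
  let base := (dir, 6%N, 6%N) in
  let W := [seq h <- grid_window | ~~ Z.eqb (grid_app Vpending base h) 0] in
  Z.eqb (sumZ (grid_app Vpending base) grid_window) Vpending_total &&
  all (fun e => grid_app overlap_at base e ||
         Z.leb (sumZ (grid_app Vpending base) [seq h <- W | grid_app overlap_at e h])
               (grid_app Vpending_over base e)) grid_window.

(** For the start of the induction: a pending pair of nonzero value has to admit a completion by one
    block. *)
Definition check_linkable (r : grid_block) : bool :=
  Z.eqb (grid_app Vpending base_block r) 0
  || has (fun d => grid_app overlap_at base_block d && grid_app overlap_at r d) grid_box.

End Certificate.

Lemma lebE m n : Nat.leb m n = (m <= n)%N.
Proof. by apply/idP/idP => [/PeanoNat.Nat.leb_le|] h; [|apply/PeanoNat.Nat.leb_le]; lia. Qed.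

Local Open Scope fset_scope.
Local Open Scope ring_scope.

(** * Growing a building layer by layer *)

Notation blk := (bool * int * int)%type.
Notation layer := {fset blk}.

Definition blk_app T (f : bool -> bool -> nat -> nat -> T) (b c : blk) : T :=
  f b.1.1 c.1.1 `|b.1.2 - c.1.2|%N `|b.2 - c.2|%N.

Definition overlap : rel blk := blk_app overlap_at.

Lemma overlap_refl b : overlap b b.
Proof. by rewrite /overlap /blk_app /overlap_at; case: b => [[[] x] y] /=; rewrite !subrr. Qed.

Lemma overlap_sym b c : overlap b c = overlap c b.
Proof.
by rewrite /overlap /blk_app /overlap_at (distnC b.1.2) (distnC b.2); case: b.1.1; case: c.1.1.
Qed.

Fixpoint inL (k : nat) (L : seq layer) (p : nat * blk) : bool :=
  if L is D :: L' then (p.1 == k) && (p.2 \in D) || inL k.+1 L' p else false.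

Definition adj (p q : nat * blk) : bool :=
  ((p.1 == q.1.+1) || (q.1 == p.1.+1)) && overlap p.2 q.2.

(** Connectedness is stated impredicatively: every equivalence relation containing adjacency relates
    all elements. Gluing arguments then chain relations and never handle paths. *)
Definition equivalent T (Q : T -> T -> Prop) : Prop :=
  [/\ forall p, Q p p, forall p q, Q p q -> Q q p
    & forall p q r, Q p q -> Q q r -> Q p r].

(* S is the layer at level k and L the layers above it.  If e holds, the blocks
   of S count as already connected by what lies below. *)
Definition glue (e : bool) (S : layer) (L : seq layer) : Prop :=
  forall (k : nat) (Q : nat * blk -> nat * blk -> Prop), equivalent Q ->
  (forall p q, inL k (S :: L) p -> inL k (S :: L) q -> adj p q -> Q p q) ->
  (e -> {in S &, forall b c, Q (k, b) (k, c)}) ->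
  forall p q, inL k (S :: L) p -> inL k (S :: L) q -> Q p q.

Lemma inL_head k S L p : p \in S -> inL k (S :: L) (k, p).
Proof. by move=> pS; rewrite /= eqxx pS. Qed.

Lemma inL_tail k S L p : inL k.+1 L p -> inL k (S :: L) p.
Proof. by move=> /= ->; rewrite orbT. Qed.

(** Only the part [D0] of the new layer has to be remembered: if [S] and the rest of [D] are tied to
    [D0], then whatever glues [D0] to the layers above glues everything. *)
Lemma glue_up (e e' : bool) (S D D0 : layer) L :
  D0 `<=` D -> (exists b, b \in D0) ->
  (forall k Q, equivalent Q ->
     {in S & D, forall s d, overlap s d -> Q (k, s) (k.+1, d)} ->
     (e -> {in S &, forall b c, Q (k, b) (k, c)}) ->
     [/\ e' -> {in D0 &, forall b c, Q (k.+1, b) (k.+1, c)},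
         {in D, forall d, exists2 d', d' \in D0 & Q (k.+1, d) (k.+1, d')}
       & {in S, forall s, exists2 d, d \in D & Q (k, s) (k.+1, d)}]) ->
  glue e' D0 L -> glue e S (D :: L).
Proof.
move=> sub [b0 b0D0] H G k Q eQ adjQ SQ.
have [rQ sQ tQ] := eQ.
have HSD : {in S & D, forall s d, overlap s d -> Q (k, s) (k.+1, d)}.
  move=> s d sS dD sd; apply: adjQ; rewrite /adj /= ?eqxx ?sS ?dD ?orbT //=.
have [H1 H2 H3] := H k Q eQ HSD SQ.
have inD0 p : inL k.+1 (D0 :: L) p -> inL k.+1 (D :: L) p.
  by move=> /= /orP[/andP[-> /(fsubsetP sub) ->]|->]; rewrite ?orbT.
have G' := G k.+1 Q eQ _ H1.
have {}G' p q : inL k.+1 (D0 :: L) p -> inL k.+1 (D0 :: L) q -> Q p q.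
  by apply: G' => p' q' /inD0/inL_tail p'L /inD0/inL_tail q'L; exact: adjQ.
have base p : inL k (S :: D :: L) p -> Q p (k.+1, b0).
  have baseD d : d \in D -> Q (k.+1, d) (k.+1, b0).
    by move=> /H2[d' d'D0 dd']; apply: tQ dd' _; apply: G'; exact: inL_head.
  move=> /= /orP[/andP[/eqP pk pS]|/orP[/andP[/eqP pk pD]|pL]].
  - have [d dD pd] := H3 _ pS.
    by apply: tQ (baseD d dD); rewrite [p]surjective_pairing pk.
  - by rewrite [p]surjective_pairing pk; exact: baseD.
  - by apply: G'; [rewrite /= pL orbT|exact: inL_head].
by move=> p q /base pb /base qb; exact: tQ pb (sQ _ _ qb).
Qed.

Lemma glue_nil (S : layer) : glue true S [::].
Proof.
by move=> k Q eQ _ SQ [i p] [j q] /=; rewrite !orbF => /andP[/eqP-> pS] /andP[/eqP-> qS]; exact: SQ.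
Qed.

(** This is why a connected pair is worth at least as much as one of its blocks. *)
Lemma glue_mono (S S' : layer) L : S `<=` S' -> (exists b, b \in S) ->
  glue true S L -> glue true S' L.
Proof.
move=> sub [b0 b0S] G k Q eQ adjQ SQ; have [rQ sQ tQ] := eQ.
have inS p : inL k (S :: L) p -> inL k (S' :: L) p.
  by move=> /= /orP[/andP[-> /(fsubsetP sub) ->]|->]; rewrite ?orbT.
have G' p q : inL k (S :: L) p -> inL k (S :: L) q -> Q p q.
  apply: G => // [p' q' /inS ? /inS ?|_ b c /(fsubsetP sub) ? /(fsubsetP sub) ?].
  - exact: adjQ.
  - exact: SQ.
have base p : inL k (S' :: L) p -> Q p (k, b0).
  move=> /= /orP[/andP[/eqP pk pS]|pL].
  - by rewrite [p]surjective_pairing pk; apply: SQ => //; exact: (fsubsetP sub).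
  - by apply: G'; [rewrite /= pL orbT|exact: inL_head].
by move=> p q /base pb /base qb; exact: tQ pb (sQ _ _ qb).
Qed.

Lemma glue_map (s : blk -> blk) e (S : layer) L :
  {mono s : b c / overlap b c} ->
  glue e S L -> glue e (s @` S) [seq s @` D | D : layer <- L].
Proof.
move=> ovs G k Q [rQ sQ tQ] adjQ SQ.
pose s' (p : nat * blk) := (p.1, s p.2).
pose Q' p q := Q (s' p) (s' q).
have inS l M p : inL l M p -> inL l [seq s @` D | D : layer <- M] (s' p).
  elim: M l => //= D M IH l /orP[/andP[-> pD]|/IH ->]; rewrite ?orbT //.
  by rewrite in_imfset.
have inS' l M p : inL l [seq s @` D | D : layer <- M] p -> exists2 q, p = s' q & inL l M q.
  elim: M l => //= D M IH l /orP[/andP[/eqP pl /imfsetP[q /= qD pq]]|/IH[q -> qM]].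
  - by exists (l, q) => /=; [rewrite /s' /= -pl -pq -surjective_pairing|rewrite eqxx qD].
  - by exists q; rewrite ?qM ?orbT.
have E : s @` S :: [seq s @` D | D : layer <- L] = [seq s @` D | D : layer <- S :: L] by [].
rewrite E => p q /inS'[p' -> p'L] /inS'[q' -> q'L].
apply: (G k Q') => //.
- by split; rewrite /Q' => *; eauto.
- move=> p1 q1 /inS p1L /inS q1L pq; apply: adjQ => //.
  by move: pq; rewrite /adj /= ovs.
- by move=> he b c bS cS; apply: SQ => //; rewrite in_imfset.
Qed.

Definition nonov (D : layer) : Prop := {in D &, forall b c, overlap b c -> b = c}.

Definition good (e : bool) (S : layer) (n : nat) (L : seq layer) : Prop :=
  [/\ glue e S L, forall D, D \in L -> nonov D /\ D != fset0
    & (\sum_(D <- L) #|` D|)%N = n].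

(** * Lower bounds for numbers of solutions *)

Section Many.
Variable R : realFieldType.

(** A witness list asks for no finiteness of [P] and no cardinal. The bound lives in a field because
    it arises as a weighted sum; a bound that is not positive is trivially met. *)
Definition many (T : eqType) (P : T -> Prop) (w : R) : Prop :=
  exists s : seq T, [/\ uniq s, forall x, x \in s -> P x & w <= (size s)%:R].

Lemma many_le (T : eqType) (P P' : T -> Prop) (w w' : R) : w' <= w -> (forall x, P x -> P' x) ->
  many P w -> many P' w'.
Proof.
move=> ww' PP' [s [us sP sw]]; exists s; split => // [x /sP/PP'//|].
exact: le_trans sw.
Qed.

Lemma many0 (T : eqType) (P : T -> Prop) (w : R) : w <= 0 -> many P w.
Proof. by move=> w0; exists [::]. Qed.

Lemma many1 (T : eqType) (P : T -> Prop) (w : R) x : P x -> w <= 1 -> many P w.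
Proof.
by move=> Px w0; exists [:: x]; split => // y; rewrite inE => /eqP->.
Qed.

Lemma many_map (T U : eqType) (f : T -> U) (P : T -> Prop) (P' : U -> Prop) (w : R) : injective f ->
  (forall x, P x -> P' (f x)) -> many P w -> many P' w.
Proof.
move=> fI PP' [s [us sP sw]]; exists (map f s); split.
- by rewrite map_inj_uniq.
- by move=> _ /mapP[x /sP/PP' Px ->].
- by rewrite size_map.
Qed.

Lemma many_add (T : eqType) (P1 P2 P : T -> Prop) (w1 w2 : R) :
  (forall x, P1 x -> P2 x -> False) -> (forall x, P1 x -> P x) ->
  (forall x, P2 x -> P x) -> many P1 w1 -> many P2 w2 -> many P (w1 + w2).
Proof.
move=> P12 P1P P2P [s [us sP sw]] [t [ut tP tw]]; exists (s ++ t); split.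
- rewrite cat_uniq us ut andbT; apply/hasPn => x xt; apply/negP => xs.
  exact: P12 (sP _ xs) (tP _ xt).
- by move=> x; rewrite mem_cat => /orP[/sP/P1P|/tP/P2P].
- by rewrite size_cat natrD lerD.
Qed.

Lemma many_sum (J T : eqType) (s : seq J) (Q : pred J) (PJ : J -> T -> Prop)
    (P : T -> Prop) (w : J -> R) : uniq s ->
  (forall i j x, i \in s -> j \in s -> PJ i x -> PJ j x -> i = j) ->
  (forall i x, i \in s -> PJ i x -> P x) ->
  (forall i, i \in s -> Q i -> many (PJ i) (w i)) ->
  many P (\sum_(i <- s | Q i) w i).
Proof.
move=> us PIJ PJP Hm.
suff: many (fun x => exists2 i, i \in s & PJ i x) (\sum_(i <- s | Q i) w i).
  by apply: many_le => // x [i si]; exact: PJP.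
elim: s us PIJ {PJP} Hm => [|i s IH] /=; first by rewrite big_nil => *; exact: many0.
move=> /andP[iNs us] PIJ Hm; rewrite big_cons.
have {}IH : many (fun x => exists2 i, i \in s & PJ i x) (\sum_(i <- s | Q i) w i).
  apply: IH => // [i' j x si sj|j sj].
  - by apply: PIJ; rewrite inE ?si ?sj orbT.
  - by apply: Hm; rewrite inE sj orbT.
case: ifP => Qi; last first.
  by apply: many_le IH => // x [j sj jx]; exists j => //; rewrite inE sj orbT.
have mi : many (PJ i) (w i) by apply: Hm => //; rewrite inE eqxx.
apply: many_add mi IH => [x ix [j sj jx]|x ix|x [j sj jx]].
- have ij : i = j by apply: PIJ ix jx; rewrite inE ?eqxx ?sj ?orbT.
  by rewrite ij sj in iNs.
- by exists i => //; rewrite inE eqxx.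
- by exists j => //; rewrite inE sj orbT.
Qed.

(** The whole layer [D] is recorded as the head, which keeps choices distinguishable, while the
    layers above are counted from the remembered part [D0]. *)
Lemma many_cons (e e' : bool) (S D D0 : layer) k n (w : R) :
  #|` D| = k.+1 -> (k < n)%N -> nonov D ->
  (forall L, glue e' D0 L -> glue e S (D :: L)) ->
  many (good e' D0 (n - k.+1)) w ->
  many (fun L => good e S n L /\ head fset0 L = D) w.
Proof.
move=> Dk kn nD H; apply: (@many_map _ _ (cons D)) => [? ? []//|L [gL vL sL]].
split=> //; split; first exact: H.
- move=> D'; rewrite inE => /predU1P[->|/vL//]; split => //.
  by rewrite -cardfs_gt0 Dk.
- by rewrite big_cons sL Dk subnKC.
Qed.

End Many.

(** * Unordered pairs and elementary properties of the tables *)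

Fixpoint pairs (T : Type) (s : seq T) : seq (T * T) :=
  if s is x :: s' then [seq (x, y) | y <- s'] ++ pairs s' else [::].

Lemma mem_pairs (T : eqType) (s : seq T) x y : uniq s -> (x, y) \in pairs s ->
  [/\ x \in s, y \in s & (index x s < index y s)%N].
Proof.
elim: s => //= z s IH /andP[zs us]; rewrite mem_cat => /orP[/mapP[y' ys [-> ->]]|/(IH us)[xs ys xy]].
  by rewrite !inE eqxx ys orbT; split => //; case: eqP => // zy; rewrite zy ys in zs.
rewrite !inE xs ys !orbT; split => //.
by case: (z =P x) => [zx|_]; [rewrite zx xs in zs|case: (z =P y) => [zy|_] //; rewrite zy ys in zs].
Qed.

Lemma uniq_pairs (T : eqType) (s : seq T) : uniq s -> uniq (pairs s).
Proof.
elim: s => //= z s IH /andP[zs us]; rewrite cat_uniq IH // andbT map_inj_uniq ?us /=; last by move=> ? ? [].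
apply/hasPn => -[x y] /(mem_pairs us)[xs _ _]; apply/mapP => -[y' _ [xz _]].
by rewrite xz in xs; rewrite xs in zs.
Qed.

Lemma pair_table_far T F dflt dir dir' p q : (size T <= 7)%N -> (size F <= 7)%N ->
  (forall p, size (nth [::] T p) <= 7)%N -> (forall p, size (nth [::] F p) <= 7)%N ->
  (6 < p)%N || (6 < q)%N -> pair_table T F dflt dir dir' p q = dflt.
Proof.
move=> sT sF hT hF pq; rewrite /pair_table.
have: let '(m, p', q') := pair_key dir dir' p q in (6 < p')%N || (6 < q')%N.
  by rewrite /pair_key; case: xorb; [case: Nat.leb|case: dir] => //; rewrite orbC.
case: (pair_key _ _ _ _) => [[m p'] q'] pq'.
have tableP A : (size A <= 7)%N -> (forall p, size (nth [::] A p) <= 7)%N ->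
    nth dflt (nth [::] A p') q' = dflt.
  move=> sA hA; have [pA|pA] := ltnP p' (size A).
    rewrite nth_default //; apply: leq_trans (hA _) _; case/orP: pq' => // p6.
    by have := leq_trans pA sA; rewrite ltnNge p6.
  by rewrite (nth_default [::]) ?nth_nil.
by case: m; exact: tableP.
Qed.

Lemma Vpending_over_far dir dir' p q : (6 < p)%N || (6 < q)%N -> Vpending_over dir dir' p q = Vpending_total.
Proof. by apply: pair_table_far => // -[|[|[|[|[|[|[|n]]]]]]] //; rewrite nth_default. Qed.

Lemma Vjoined_far dir dir' p q : (6 < p)%N || (6 < q)%N -> Vjoined dir dir' p q = Vsingle.
Proof. by apply: pair_table_far => // -[|[|[|[|[|[|[|n]]]]]]] //; rewrite nth_default. Qed.

Lemma Vpending_far dir dir' p q : (6 < p)%N || (6 < q)%N -> Vpending dir dir' p q = Z0.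
Proof. by apply: pair_table_far => // -[|[|[|[|[|[|[|n]]]]]]] //; rewrite nth_default. Qed.

Lemma pair_table_all (P : pred Z) T F dflt dir dir' p q : all (all P) T -> all (all P) F ->
  P dflt -> P (pair_table T F dflt dir dir' p q).
Proof.
move=> hT hF hd; rewrite /pair_table; case: (pair_key _ _ _ _) => [[m p'] q'].
have tableP A : all (all P) A -> P (nth dflt (nth [::] A p') q').
  move=> hA; have [pA|pA] := ltnP p' (size A); last by rewrite (nth_default [::]) ?nth_nil.
  have /all_nthP h := all_nthP [::] hA _ pA.
  have [qA|qA] := ltnP q' (size (nth [::] A p')); last by rewrite nth_default.
  exact: (h dflt).
by case: m; exact: tableP.
Qed.

Lemma Vpending_ge0 dir dir' p q : Z.le Z0 (Vpending dir dir' p q).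
Proof. by apply: Zle_bool_imp_le; apply: pair_table_all. Qed.

Definition Vmax : Z := Z.mul 100 100.

Lemma Vpending_le dir dir' p q : Z.le (Vpending dir dir' p q) Vmax.
Proof. by apply: Zle_bool_imp_le; apply: (@pair_table_all (fun x => Z.leb x Vmax)). Qed.

Lemma Vjoined_le dir dir' p q : Z.le (Vjoined dir dir' p q) Vmax.
Proof. by apply: Zle_bool_imp_le; apply: (@pair_table_all (fun x => Z.leb x Vmax)). Qed.

Lemma Vpending_overlap dir dir' p q : overlap_at dir dir' p q -> Vpending dir dir' p q = Z0.
Proof.
move=> h; have : (p <= 3)%N && (q <= 3)%N.
  move: h; rewrite /overlap_at !lebE; case: dir; case: dir' => /= /andP[hp hq]; lia.
by move: p q h => [|[|[|[|p]]]] [|[|[|[|q]]]] //; case: dir; case: dir'.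
Qed.

(** * From integer computations to an ordered field and signed coordinates *)

Section Embed.
Variable R : realFieldType.
Definition ZtoR (z : Z) : R := (int_of_Z z)%:~R.
Lemma ZtoRD x y : ZtoR (Z.add x y) = ZtoR x + ZtoR y.
Proof. by rewrite /ZtoR -intrD; congr (_%:~R); lia. Qed.
Lemma ZtoRM x y : ZtoR (Z.mul x y) = ZtoR x * ZtoR y.
Proof. by rewrite /ZtoR -intrM; congr (_%:~R); lia. Qed.
Lemma ZtoRB x y : ZtoR (Z.sub x y) = ZtoR x - ZtoR y.
Proof. by rewrite /ZtoR -intrB; congr (_%:~R); lia. Qed.
Lemma ZtoR_le x y : Z.le x y -> ZtoR x <= ZtoR y.
Proof. by move=> xy; rewrite /ZtoR ler_int; lia. Qed.
Lemma ZtoR_gt0 z : Z.lt Z0 z -> 0 < ZtoR z.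
Proof. by move=> z0; rewrite /ZtoR ltr0z; lia. Qed.
Lemma ZtoR_sum (T : Type) (f : T -> Z) s : ZtoR (sumZ f s) = \sum_(x <- s) ZtoR (f x).
Proof. by elim: s => [|x s IH]; [rewrite big_nil|rewrite big_cons -IH -ZtoRD]. Qed.
Lemma ZtoR0 : ZtoR Z0 = 0. Proof. by []. Qed.
Lemma ZtoR_max x y : ZtoR (Z.max x y) = Num.max (ZtoR x) (ZtoR y).
Proof.
case: (Z.le_ge_cases x y) => xy.
  by rewrite Z.max_r // max_r // ZtoR_le.
by rewrite Z.max_l // max_l // ZtoR_le.
Qed.
Lemma ZtoR_cent : ZtoR cent = 100.
Proof. by []. Qed.
Lemma ZtoR_mu : ZtoR mu = 78 * 100 + 33.
Proof.
have -> : mu = Z.add (Z.mul (Zpos 78) cent) (Zpos 33) by [].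
by rewrite ZtoRD ZtoRM ZtoR_cent.
Qed.
End Embed.
(* Keeps conversion from unfolding the tables. *)
Global Opaque ZtoR mu cent Vsingle Vjoined Vpending Vpending_over.

Definition embed (c : grid_block) : blk := (c.1.1, Posz c.1.2, Posz c.2).

Lemma embed_inj : injective embed.
Proof. by move=> [[dir x] y] [[dir' x'] y'] [-> -> ->]. Qed.

Lemma blk_app_embed T (f : bool -> bool -> nat -> nat -> T) b c :
  blk_app f (embed b) (embed c) = grid_app f b c.
Proof.
move: b c => [[dir x] y] [[dir' x'] y']; rewrite /blk_app /grid_app /=.
by congr (f _ _ _ _); rewrite !ndistE; lia.
Qed.

(** In the certificate the origin is placed at 6, the largest difference stored in the tables, so
    that negative offsets become natural numbers. *)
Definition shift (d : blk) (h : grid_block) : blk :=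
  (h.1.1, d.1.2 + (h.1.2%:Z - 6%:Z), d.2 + (h.2%:Z - 6%:Z)).

Lemma blk_app_shift T (f : bool -> bool -> nat -> nat -> T) d h :
  blk_app f d (shift d h) = grid_app f (d.1.1, 6%N, 6%N) h.
Proof.
move: d h => [[dir x] y] [[dir' x'] y']; rewrite /blk_app /grid_app /=.
by congr (f _ _ _ _); rewrite !ndistE; lia.
Qed.

Lemma overlap_shift d e h : overlap (shift d e) (shift d h) = grid_app overlap_at e h.
Proof.
move: d e h => [[dir x] y] [[dir' x'] y'] [[dir2 x2] y2]; rewrite /overlap /blk_app /grid_app /=.
by congr (overlap_at _ _ _ _); rewrite !ndistE; lia.
Qed.

Definition window (d : blk) : seq blk := [seq shift d h | h <- grid_window].

Arguments window : simpl never.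

Lemma uniq_window d : uniq (window d).
Proof.
rewrite map_inj_uniq; first by vm_compute.
move=> [[dir x] y] [[dir' x'] y'] []; rewrite /= => -> xx yy.
by congr (_, _, _); lia.
Qed.

Lemma check_windowP : all check_window [:: false; true].
Proof. by vm_compute. Qed.

Lemma check_windowE dir (o0 := (dir, 6%N, 6%N)) :
  sumZ (grid_app Vpending o0) grid_window = Vpending_total /\
  forall e, e \in grid_window -> ~~ grid_app overlap_at o0 e ->
    Z.le (sumZ (grid_app Vpending o0)
       [seq h <- [seq h <- grid_window | ~~ Z.eqb (grid_app Vpending o0 h) Z0]
       | grid_app overlap_at e h]) (grid_app Vpending_over o0 e).
Proof.
have : check_window dir by move/allP: check_windowP; apply; case: (dir).
move=> /andP[/Z.eqb_eq -> /allP H]; split=> // e /H; rewrite -/o0.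
by move=> /orP[->//|/Z.leb_le].
Qed.

Section Sums.
Variable R : realFieldType.
Notation ZtoR := (ZtoR R).

Lemma sum_window d : \sum_(h <- window d) ZtoR (blk_app Vpending d h) = ZtoR Vpending_total.
Proof.
have [<- _] := check_windowE d.1.1; rewrite ZtoR_sum big_map.
by apply: eq_bigr => h _; rewrite blk_app_shift.
Qed.

Lemma ZtoR_ge0 z : Z.le Z0 z -> 0 <= ZtoR z.
Proof. by move=> z0; exact: (@ZtoR_le R Z0). Qed.

Lemma sum_shift d (P : pred grid_block) :
  ZtoR (sumZ (grid_app Vpending (d.1.1, 6%N, 6%N))
    [seq h <- [seq h <- grid_window | ~~ Z.eqb (grid_app Vpending (d.1.1, 6%N, 6%N) h) Z0] | P h]) =
  \sum_(h <- grid_window | P h) ZtoR (blk_app Vpending d (shift d h)).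
Proof.
rewrite ZtoR_sum !big_filter_cond big_mkcond [RHS]big_mkcond; apply: eq_bigr => h _.
by rewrite blk_app_shift; case: (P h); case: Z.eqb_spec => // ->.
Qed.

Lemma mem_grid_window dir x y : (x < 13)%N -> (y < 13)%N -> (dir, x, y) \in grid_window.
Proof.
move=> hx hy; rewrite /grid_window.
apply: (allpairs_f (fun ox y => (ox, y))); last by rewrite mem_iota; lia.
apply: (allpairs_f (fun dir x => (dir, x))); last by rewrite mem_iota; lia.
by case: dir.
Qed.

(** For a far block [e] the table returns its default, the sum over the whole window. A near one is
    a translate of a grid block and is covered by the computation. *)
Lemma sum_window_ov d e : ~~ overlap d e ->
  \sum_(h <- window d | overlap e h) ZtoR (blk_app Vpending d h) <= ZtoR (blk_app Vpending_over d e).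
Proof.
move=> de.
have [far|near] := boolP ((6 < `|d.1.2 - e.1.2|)%N || (6 < `|d.2 - e.2|)%N).
  rewrite {2}/blk_app Vpending_over_far // -(sum_window d) [leRHS](bigID (overlap e)) /= lerDl.
  by apply: sumr_ge0 => h _; apply: ZtoR_ge0; exact: Vpending_ge0.
pose e0 : grid_block := (e.1.1, absz (e.1.2 - d.1.2 + 6%:Z), absz (e.2 - d.2 + 6%:Z)).
have ee : e = shift d e0.
  by move: d e @e0 near {de} => [[dir x] y] [[dir' x'] y'] /=; rewrite /shift /= => near; congr (_, _, _); lia.
have e0W : e0 \in grid_window.
  by move: near; rewrite /e0 => near; apply: mem_grid_window; lia.
have [_ /(_ e0 e0W)] := check_windowE d.1.1.
rewrite -(blk_app_shift overlap_at) -ee => /(_ de)/(ZtoR_le R).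
rewrite -(blk_app_shift Vpending_over) -ee; apply: le_trans; rewrite sum_shift big_map le_eqVlt.
by apply/orP; left; apply/eqP; apply: eq_bigl => h; rewrite {1}ee overlap_shift.
Qed.

(** Positions overlapping [d] have value zero, and members of [U] outside the window can only
    increase what is subtracted. *)
Lemma pending_weight_le (U : seq blk) d : uniq U ->
  ZtoR (pending_weight blk_app U d) <=
    \sum_(h <- window d | (h \notin U) && ~~ overlap d h) ZtoR (blk_app Vpending d h).
Proof.
move=> uU; rewrite /pending_weight ZtoRB ZtoR_sum -(sum_window d) lerBlDr.
rewrite (bigID (mem U)) /= addrC lerD //.
  rewrite [leLHS](bigID (overlap d)) /= [X in X + _]big1 ?add0r //.
  by move=> h /andP[_ dh]; rewrite /blk_app Vpending_overlap.
rewrite -big_filter (perm_big [seq h <- U | h \in window d]).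
  rewrite big_filter [leRHS](bigID (mem (window d))) /= lerDl.
  by apply: sumr_ge0 => h _; apply: ZtoR_ge0; exact: Vpending_ge0.
apply: uniq_perm; rewrite ?filter_uniq ?uniq_window // => h.
by rewrite !mem_filter andbC.
Qed.

Lemma pending_weight_over_le (U : seq blk) d e : uniq U -> ~~ overlap d e ->
  ZtoR (Z.max Z0 (Z.sub (pending_weight blk_app U d) (blk_app Vpending_over d e))) <=
  \sum_(h <- window d | [&& h \notin U, ~~ overlap d h & ~~ overlap e h]) ZtoR (blk_app Vpending d h).
Proof.
move=> uU de; rewrite ZtoR_max ge_max; apply/andP; split.
  by apply: sumr_ge0 => h _; apply: ZtoR_ge0; exact: Vpending_ge0.
rewrite ZtoRB lerBlDr; apply: le_trans (pending_weight_le d uU) _.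
rewrite (bigID (overlap e)) /= addrC lerD //.
  rewrite le_eqVlt; apply/orP; left; apply/eqP.
  by apply: eq_bigl => h; rewrite andbA.
apply: le_trans (sum_window_ov de); rewrite [leRHS](bigID (fun h => (h \notin U) && ~~ overlap d h)) /=.
rewrite ler_wpDr //; first by apply: sumr_ge0 => h _; apply: ZtoR_ge0; exact: Vpending_ge0.
by rewrite le_eqVlt; apply/orP; left; apply/eqP; apply: eq_bigl => h; rewrite andbC.
Qed.
End Sums.

(** * Layers that preserve connectedness *)

Definition linked (e : bool) (S : layer) (d : blk) : Prop :=
  forall k (Q : nat * blk -> nat * blk -> Prop), equivalent Q ->
  {in S, forall s, overlap s d -> Q (k, s) (k.+1, d)} ->
  (e -> {in S &, forall b c, Q (k, b) (k, c)}) ->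
  {in S, forall s, Q (k, s) (k.+1, d)}.

Definition touching (S : layer) (d : blk) : Prop := exists2 s, s \in S & overlap s d.

(** A single contact reaches all of a layer that is already connected; above a pending pair, contact
    with both blocks is used instead. *)
Lemma linked_touching S d : touching S d -> linked true S d.
Proof.
move=> [s sS sd] k Q [rQ sQ tQ] Qd SQ b bS.
by apply: tQ (Qd _ sS sd); apply: SQ.
Qed.

Lemma linked_all e (S : layer) d : {in S, forall s, overlap s d} -> linked e S d.
Proof. by move=> Sd k Q eQ Qd _ s sS; apply: Qd => //; exact: Sd. Qed.

Lemma glue_link1 e S d L : linked e S d -> glue true [fset d] L -> glue e S ([fset d] :: L).
Proof.
move=> ld; apply: glue_up => //; first by exists d; rewrite inE.
move=> k Q eQ adjQ SQ; have [rQ sQ tQ] := eQ; split.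
- by move=> _ b c /fset1P-> /fset1P->.
- by move=> b /fset1P->; exists d; rewrite ?inE.
- move=> s sS; exists d; first by rewrite inE.
  by apply: (ld k Q) => // s' s'S; apply: adjQ; rewrite ?inE.
Qed.

Lemma glue_link2 e S d d' L : linked e S d -> touching S d' ->
  glue true [fset d; d'] L -> glue e S ([fset d; d'] :: L).
Proof.
move=> ld [s' s'S sd']; apply: glue_up => //; first by exists d; rewrite !inE eqxx.
move=> k Q eQ adjQ SQ; have [rQ sQ tQ] := eQ.
have Qd : {in S, forall s, Q (k, s) (k.+1, d)}.
  by apply: (ld k Q) => // s sS; apply: adjQ; rewrite ?inE ?eqxx.
have dd' : Q (k.+1, d) (k.+1, d').
  apply: tQ (sQ _ _ (Qd _ s'S)) _.
  by apply: adjQ => //; rewrite !inE eqxx orbT.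
split.
- by move=> _ b c /fset2P[]-> /fset2P[]-> //; exact: sQ.
- by move=> b bD; exists b.
- by move=> s sS; exists d; rewrite ?inE ?eqxx //; exact: Qd.
Qed.

Lemma glue_pend e S d h L : linked e S d -> glue false [fset d; h] L -> glue e S ([fset d; h] :: L).
Proof.
move=> ld; apply: glue_up => //; first by exists d; rewrite !inE eqxx.
move=> k Q eQ adjQ SQ; have [rQ sQ tQ] := eQ; split => //.
- by move=> b bD; exists b.
- move=> s sS; exists d; first by rewrite !inE eqxx.
  by apply: (ld k Q) => // s' s'S; apply: adjQ; rewrite ?inE ?eqxx.
Qed.

(** Of the three blocks only [d] and [h] are remembered: [d'] is joined to [d] through the layer
    below, whichever of the two is linked to it. *)
Lemma glue_link_pend e S d d' h L :
  (linked e S d /\ touching S d') \/ (linked e S d' /\ touching S d) ->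
  glue false [fset d; h] L -> glue e S ([fset d; d'; h] :: L).
Proof.
move=> ld; have dD : d \in [fset d; d'; h] by rewrite !inE eqxx.
have d'D : d' \in [fset d; d'; h] by rewrite !inE eqxx orbT.
apply: glue_up => //.
- by apply/fsubsetP => x; rewrite !inE => /orP[]->; rewrite ?orbT.
- by exists d; rewrite !inE eqxx.
move=> k Q eQ adjQ SQ; have [rQ sQ tQ] := eQ.
have [Qd dd'] : {in S, forall s, Q (k, s) (k.+1, d)} /\ Q (k.+1, d') (k.+1, d).
  case: ld => -[ld [s' s'S sd']].
    have Qd : {in S, forall s, Q (k, s) (k.+1, d)}.
      by apply: (ld k Q) => // s sS; apply: adjQ.
    by split => //; apply: tQ (Qd _ s'S); apply: sQ; exact: adjQ.
  have Qd' : {in S, forall s, Q (k, s) (k.+1, d')}.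
    by apply: (ld k Q) => // s sS; apply: adjQ.
  have dd' : Q (k.+1, d') (k.+1, d).
    by apply: tQ (sQ _ _ (Qd' _ s'S)) _; apply: adjQ.
  by split => // s sS; apply: tQ dd'; exact: Qd'.
split => //.
- move=> b; rewrite !inE => /orP[/orP[]|] /eqP->.
  + by exists d; rewrite ?inE ?eqxx.
  + by exists d; rewrite ?inE ?eqxx.
  + by exists h; rewrite ?inE ?eqxx ?orbT.
- by move=> s sS; exists d => //; exact: Qd.
Qed.

Definition crossing (S : layer) (d d' : blk) : Prop := {in S, forall s, overlap s d \/ overlap s d'}.

(** The layer itself joins nothing, but each block of [S] continues in [d] or in [d'], so a later
    junction of these two also connects [S]. *)
Lemma glue_cross e S d d' L : crossing S d d' ->
  glue false [fset d; d'] L -> glue e S ([fset d; d'] :: L).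
Proof.
move=> cr; apply: glue_up => //; first by exists d; rewrite !inE eqxx.
move=> k Q eQ adjQ SQ; have [rQ sQ tQ] := eQ; split => //.
- by move=> b bD; exists b.
- move=> s sS; have [sd|sd] := cr _ sS.
  + by exists d; [|apply: adjQ]; rewrite ?inE ?eqxx.
  + by exists d'; [|apply: adjQ]; rewrite ?inE ?eqxx ?orbT.
Qed.

Lemma not_overlap_neq b c : ~~ overlap b c -> b != c.
Proof. by apply: contraNneq => ->; exact: overlap_refl. Qed.

Lemma nonov1 d : nonov [fset d].
Proof. by move=> b c /fset1P-> /fset1P->. Qed.

Lemma nonov2 d d' : ~~ overlap d d' -> nonov [fset d; d'].
Proof.
move=> dd' b c /fset2P[]-> /fset2P[]-> //; first by rewrite (negPf dd').
by rewrite overlap_sym (negPf dd').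
Qed.

Lemma nonov3 d d' h : ~~ overlap d d' -> ~~ overlap d h -> ~~ overlap d' h -> nonov [fset d; d'; h].
Proof.
move=> h1 h2 h3 b c; rewrite !inE => /orP[/orP[]|] /eqP-> /orP[/orP[]|] /eqP-> //;
by rewrite ?(negPf h1) ?(negPf h2) ?(negPf h3) // overlap_sym ?(negPf h1) ?(negPf h2) ?(negPf h3).
Qed.

Lemma card2 (d d' : blk) : ~~ overlap d d' -> #|` [fset d; d']| = 2%N.
Proof. by move=> /not_overlap_neq dd'; rewrite cardfs2 dd'. Qed.

Lemma card3 (d d' h : blk) : ~~ overlap d d' -> ~~ overlap d h -> ~~ overlap d' h ->
  #|` [fset d; d'; h]| = 3%N.
Proof.
move=> h1 h2 h3; rewrite fsetUC cardfsU1 card2 // !inE.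
by rewrite ![h == _]eq_sym (negPf (not_overlap_neq h2)) (negPf (not_overlap_neq h3)).
Qed.

(** * Adding one layer *)

Section Step.
Variable R : realFieldType.
Notation ZtoR := (ZtoR R).

Lemma ZtoR_total (U : seq blk) ok cross s :
  ZtoR (total blk_app U ok cross s) =
  \sum_(d <- s | ok d) ZtoR mu * (ZtoR mu * ZtoR Vsingle) +
  \sum_(d <- s | ok d) ZtoR cent * (ZtoR mu * ZtoR (pending_weight blk_app U d)) +
  \sum_(p <- pairs s) ZtoR cent *
    ZtoR (pair_weight blk_app ok cross p.1 (ok p.1) (pending_weight blk_app U p.1) p.2).
Proof.
elim: s => [|d s IH]; first by rewrite !big_nil !addr0.
have -> : total blk_app U ok cross (d :: s) =
  Z.add (if ok d then Z.add (Z.mul mu (Z.mul mu Vsingle))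
      (Z.mul cent (Z.mul mu (pending_weight blk_app U d))) else Z0)
   (Z.add (Z.mul cent (sumZ (pair_weight blk_app ok cross d (ok d) (pending_weight blk_app U d)) s)) (total blk_app U ok cross s)) by [].
have -> : pairs (d :: s) = [seq (d, y) | y <- s] ++ pairs s by [].
rewrite !(big_cons _ _ d) big_cat big_map /=; move: (pending_weight blk_app U d) => r.
rewrite !ZtoRD IH ZtoRM ZtoR_sum mulr_sumr; set q := \sum_(i <- s) ZtoR cent * _.
set A := \sum_(d <- s | _) _; set B := \sum_(d <- s | _) _; set C := \sum_(d <- pairs s) _.
by case: (ok d); rewrite ?ZtoRD ?ZtoRM ?ZtoR0; move: (ZtoR mu) (ZtoR cent) (ZtoR Vsingle) (ZtoR r) q A B C => *; ring.
Qed.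

(** The pending block lies outside [U], so the trace recovers the other blocks of the layer; this
    separates the families being counted. *)
Definition trace (U : seq blk) (D : layer) : layer := [fset x in D | x \in U].

Lemma trace1 U d : d \in U -> trace U [fset d] = [fset d].
Proof. by move=> dU; apply/fsetP => x; rewrite !inE /=; case: eqP => // ->. Qed.

Lemma trace2 U d d' : d \in U -> d' \in U -> trace U [fset d; d'] = [fset d; d'].
Proof.
move=> dU d'U; apply/fsetP => x; rewrite !inE /=.
by case: eqP => [->|_] /=; [rewrite dU|case: eqP => // ->].
Qed.

Lemma trace_pend U D h : h \notin U -> trace U (D `|` [fset h]) = trace U D.
Proof.
move=> hU; apply/fsetP => x; rewrite !inE /=.
by case: eqP => [->|_]; rewrite ?(negPf hU) ?andbF // orbF.
Qed.

Variables (e : bool) (S : layer) (n : nat) (U : seq blk).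
Variables (ok : blk -> bool) (cross : blk -> blk -> bool) (w : R).
Hypotheses (uU : uniq U) (w0 : 0 <= w) (n3 : (3 < n)%N).
Hypothesis U_touching : {in U, forall d, touching S d}.
Hypothesis ok_linked : {in U, forall d, ok d -> linked e S d}.
Hypothesis cross_crossing : {in U &, forall d d', cross d d' -> crossing S d d'}.
Hypothesis many_single : forall d,
  many (good true [fset d] (n - 1)) (ZtoR Vsingle * (ZtoR mu * (ZtoR mu * w))).
Hypothesis many_pair : forall d d', ~~ overlap d d' ->
  many (good true [fset d; d'] (n - 2)) (ZtoR (blk_app Vjoined d d') * (ZtoR mu * (ZtoR cent * w))).
Hypothesis many_pend2 : forall d d', ~~ overlap d d' ->
  many (good false [fset d; d'] (n - 2)) (ZtoR (blk_app Vpending d d') * (ZtoR mu * (ZtoR cent * w))).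
Hypothesis many_pend3 : forall d d', ~~ overlap d d' ->
  many (good false [fset d; d'] (n - 3)) (ZtoR (blk_app Vpending d d') * (ZtoR cent * (ZtoR cent * w))).

Let P (D : layer) (L : seq layer) := good e S n L /\ head fset0 L = D.

Lemma many_singles :
  many (fun L => good e S n L /\ exists2 d, d \in U & head fset0 L = [fset d])
    (\sum_(d <- U | ok d) ZtoR mu * (ZtoR mu * ZtoR Vsingle) * w).
Proof.
apply: (many_sum (PJ := fun d => P [fset d])) => //.
- by move=> i j L _ _ [_ hi] [_ hj]; apply: fset1_inj; rewrite -hi -hj.
- by move=> i L iU [gL hL]; split => //; exists i.
move=> d dU okd.
have -> : ZtoR mu * (ZtoR mu * ZtoR Vsingle) * w = ZtoR Vsingle * (ZtoR mu * (ZtoR mu * w)) by ring.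
apply: (@many_cons _ e true S [fset d] [fset d] 0); rewrite ?cardfs1 //; first by exact: ltn_trans n3.
- exact: nonov1.
- by move=> L; apply: glue_link1; exact: ok_linked.
Qed.

Lemma many_pendings :
  many (fun L => [/\ good e S n L, #|` head fset0 L| = 2%N &
       exists2 d, d \in U & trace U (head fset0 L) = [fset d]])
    (\sum_(d <- U | ok d) ZtoR cent * (ZtoR mu * ZtoR (pending_weight blk_app U d)) * w).
Proof.
apply: (many_sum (PJ := fun d L => [/\ good e S n L, #|` head fset0 L| = 2%N &
       trace U (head fset0 L) = [fset d]])) => //.
- by move=> i j L _ _ [_ _ hi] [_ _ hj]; apply: fset1_inj; rewrite -hi -hj.
- by move=> i L iU [gL hL tL]; split => //; exists i.
move=> d dU okd.
apply: (@many_le _ _ (fun L => exists2 h, h \in window d & [/\ h \notin U, ~~ overlap d h & P [fset d; h] L])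
  _ (\sum_(h <- window d | (h \notin U) && ~~ overlap d h) ZtoR (blk_app Vpending d h) * (ZtoR mu * (ZtoR cent * w)))).
- have -> : ZtoR cent * (ZtoR mu * ZtoR (pending_weight blk_app U d)) * w =
    ZtoR (pending_weight blk_app U d) * (ZtoR mu * (ZtoR cent * w)) by ring.
  by rewrite -mulr_suml ler_wpM2r ?pending_weight_le // !mulr_ge0 // ZtoR_ge0.
- move=> L [h _ [hU dh [gL ->]]]; split => //; first exact: card2.
  by rewrite trace_pend // trace1.
apply: (many_sum (PJ := fun h L => [/\ h \notin U, ~~ overlap d h & P [fset d; h] L])) => //.
- exact: uniq_window.
- move=> i j L _ _ [iU di [_ Ei]] [jU dj [_ Ej]].
  have : i \in [fset d; j] by rewrite -Ej Ei !inE eqxx orbT.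
  by rewrite !inE => /orP[/eqP id|/eqP//]; rewrite id dU in iU.
- by move=> h L hW ?; exists h.
move=> h hW /andP[hU dh].
apply: (@many_le _ _ (P [fset d; h]) _ _ _ (lexx _)); first by [].
apply: (@many_cons _ e false S _ [fset d; h] 1); [exact: card2|by exact: ltn_trans n3|..].
- exact: nonov2.
- by move=> L; apply: glue_pend; exact: ok_linked.
- exact: many_pend2.
Qed.

Lemma pair_weightE d okd r d' : pair_weight blk_app ok cross d okd r d' =
  if overlap d d' then Z0 else
  if okd || ok d' then
    Z.add (Z.mul mu (blk_app Vjoined d d'))
      (Z.mul cent (Z.max Z0 (Z.sub r (blk_app Vpending_over d d'))))
  else if cross d d' then Z.mul mu (blk_app Vpending d d') else Z0.
Proof. by []. Qed.

(** The layers [{d, d'}] and [{d, d', h}] have the same trace and are told apart by their sizes. *)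
Lemma many_pairs (Ppair := fun p L => good e S n L /\ trace U (head fset0 L) = [fset p.1; p.2]) :
  {in pairs U, forall p, many (Ppair p)
    (ZtoR cent * ZtoR (pair_weight blk_app ok cross p.1 (ok p.1) (pending_weight blk_app U p.1) p.2) * w)}.
Proof.
move=> [d d'] /(mem_pairs uU)[dU d'U _]; rewrite pair_weightE /=.
have [dd'|dd'] := boolP (overlap d d'); first by apply: many0; rewrite ZtoR0 mulr0 mul0r.
case: ifP => [okp|_]; last first.
  case: ifP => [cr|_]; last by apply: many0; rewrite ZtoR0 mulr0 mul0r.
  rewrite ZtoRM; have -> : ZtoR cent * (ZtoR mu * ZtoR (blk_app Vpending d d')) * w =
    ZtoR (blk_app Vpending d d') * (ZtoR mu * (ZtoR cent * w)) by ring.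
  apply: (@many_le _ _ (P [fset d; d']) _ _ _ (lexx _)).
    by move=> L [gL hL]; split; rewrite // hL trace2.
  apply: (@many_cons _ e false S _ [fset d; d'] 1); [exact: card2|by exact: ltn_trans n3|..].
  - exact: nonov2.
  - by move=> L; apply: glue_cross; exact: cross_crossing.
  - exact: many_pend2.
have lk : (linked e S d /\ touching S d') \/ (linked e S d' /\ touching S d).
  by case/orP: okp => okd; [left|right]; split; by [exact: ok_linked|exact: U_touching].
rewrite ZtoRD !ZtoRM.
set m := Z.max _ _.
have -> : ZtoR cent * (ZtoR mu * ZtoR (blk_app Vjoined d d') + ZtoR cent * ZtoR m) * w =
  ZtoR (blk_app Vjoined d d') * (ZtoR mu * (ZtoR cent * w)) + ZtoR m * (ZtoR cent * (ZtoR cent * w)) by ring.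
apply: (@many_add _ _ (P [fset d; d']) (fun L => exists2 h, h \in window d &
   [/\ h \notin U, ~~ overlap d h, ~~ overlap d' h & P [fset d; d'; h] L])).
- move=> L [_ hL] [h _ [_ h1 h2 [_]]]; rewrite hL => /(congr1 (fun D : layer => #|` D|)).
  by rewrite card2 // card3.
- by move=> L [gL hL]; split; rewrite // hL trace2.
- by move=> L [h _ [hU h1 h2 [gL hL]]]; split; rewrite // hL trace_pend // trace2.
- apply: (@many_cons _ e true S _ [fset d; d'] 1); [exact: card2|by exact: ltn_trans n3|..].
  + exact: nonov2.
  + move=> L G; case: lk => -[lk td]; first exact: glue_link2.
    by rewrite fsetUC; apply: glue_link2 => //; rewrite fsetUC.
  + exact: many_pair.
- apply: (@many_le _ _ (fun L => exists2 h, h \in window d &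
     [/\ h \notin U, ~~ overlap d h, ~~ overlap d' h & P [fset d; d'; h] L]) _
    (\sum_(h <- window d | [&& h \notin U, ~~ overlap d h & ~~ overlap d' h])
       ZtoR (blk_app Vpending d h) * (ZtoR cent * (ZtoR cent * w)))) => //.
    by rewrite -mulr_suml ler_wpM2r ?pending_weight_over_le // !mulr_ge0 // ZtoR_ge0.
  apply: (many_sum (PJ := fun h L =>
    [/\ h \notin U, ~~ overlap d h, ~~ overlap d' h & P [fset d; d'; h] L])) => //.
  + exact: uniq_window.
  + move=> i j L _ _ [iU di d'i [_ Ei]] [jU dj d'j [_ Ej]].
    have : i \in [fset d; d'; j] by rewrite -Ej Ei !inE eqxx !orbT.
    by rewrite !inE => /orP[/orP[]/eqP id|/eqP//]; move: iU; rewrite id ?dU ?d'U.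
  + by move=> h L hW ?; exists h.
  move=> h hW /and3P[hU dh d'h].
  apply: (@many_le _ _ (P [fset d; d'; h]) _ _ _ (lexx _)); first by [].
  apply: (@many_cons _ e false S _ [fset d; h] 2).
  + exact: card3.
  + by exact: ltn_trans n3.
  + exact: nonov3.
  + by move=> L; exact: glue_link_pend.
  + exact: many_pend3.
Qed.

(** The trace has one element for the layers [{d}] and [{d, h}], which differ in size, and two
    elements for all other layers. *)
Lemma many_step : many (good e S n) (ZtoR (total blk_app U ok cross U) * w).
Proof.
rewrite ZtoR_total 2!mulrDl.
rewrite [X in X + _ + _]mulr_suml [X in _ + X + _]mulr_suml [X in _ + _ + X]mulr_suml.
apply: (@many_add _ _ (fun L => good e S n L /\ exists2 d, d \in U & trace U (head fset0 L) = [fset d])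
  (fun L => exists2 p, p \in pairs U & good e S n L /\ trace U (head fset0 L) = [fset p.1; p.2])).
- move=> L [_ [d _ ->]] [[p1 p2] /(mem_pairs uU)[_ _ /= p12] [_ /= E]].
  have [E1 E2] : p1 = d /\ p2 = d.
    by split; apply/fset1P; rewrite E !inE eqxx ?orbT.
  by rewrite E1 E2 ltnn in p12.
- by move=> L [].
- by move=> L [p _ []].
- apply: (@many_add _ _ (fun L => good e S n L /\ exists2 d, d \in U & head fset0 L = [fset d])
    (fun L => [/\ good e S n L, #|` head fset0 L| = 2%N &
       exists2 d, d \in U & trace U (head fset0 L) = [fset d]])).
  + by move=> L [_ [d _ ->]] [_]; rewrite cardfs1.
  + by move=> L [gL [d dU hL]]; split => //; exists d; rewrite // hL trace1.
  + by move=> L [gL _ tL].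
  + exact: many_singles.
  + exact: many_pendings.
- apply: (many_sum (PJ := fun p L => good e S n L /\ trace U (head fset0 L) = [fset p.1; p.2])).
  + exact: uniq_pairs.
  + move=> [i1 i2] [j1 j2] L /(mem_pairs uU)[_ _ /= i12] /(mem_pairs uU)[_ _ /= j12] [_ hi] [_ hj].
    have E : [fset i1; i2] = [fset j1; j2] by rewrite -[LHS]hi -[RHS]hj.
    have : i1 \in [fset j1; j2] by rewrite -E !inE eqxx.
    have : i2 \in [fset j1; j2] by rewrite -E !inE eqxx orbT.
    move: i12; rewrite !inE => i12 /orP[]/eqP E2 /orP[]/eqP E1; move: i12; rewrite E1 E2 ?ltnn //.
    by move=> /ltn_trans /(_ j12); rewrite ltnn.
  + by move=> p L pU ?; exists p.
  + by move=> p pU _; exact: many_pairs.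
Qed.
End Step.

(** * Reduction to representative pairs *)

Definition symmetry (s : blk -> blk) : Prop := injective s /\ {mono s : b c / overlap b c}.

Lemma many_symmetry (R : realFieldType) s e (S : layer) n (w : R) : symmetry s ->
  many (good e S n) w -> many (good e (s @` S) n) w.
Proof.
move=> [sI sov]; have sfI : injective (fun D : layer => s @` D).
  have sub (D D' : layer) : s @` D = s @` D' -> {subset D <= D'}.
    move=> DD' x xD; have : s x \in s @` D' by rewrite -DD' in_imfset.
    by move=> /imfsetP[y /= yD' /sI ->].
  by move=> D D' DD'; apply/fsetP => x; apply/idP/idP; exact: sub.
apply: (@many_map _ _ _ (map (fun D : layer => s @` D))) => [|L [gL vL sL]]; first exact: inj_map.
split; first exact: glue_map.
- move=> _ /mapP[D /vL[nD D0] ->]; split.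
  + by move=> _ _ /imfsetP[b /= bD ->] /imfsetP[c /= cD ->]; rewrite sov => /nD ->.
  + by rewrite -cardfs_gt0 card_imfset // cardfs_gt0.
- by rewrite -sL big_map; apply: eq_bigr => D _; rewrite card_imfset.
Qed.

(** The base centre (6, 6) goes to [(x0, y0)]; transposing also switches the orientation.
    Reflections are allowed here although they are not motions: they act injectively on lists of
    layers and preserve overlap. *)
Definition affine (t : bool) (x0 y0 : int) (sx sy : bool) (b : blk) : blk :=
  let u := (if t then b.2 else b.1.2) - 6%:Z in
  let v := (if t then b.1.2 else b.2) - 6%:Z in
  (t (+) b.1.1, x0 + (if sx then - u else u), y0 + (if sy then - v else v)).

Lemma affine_symmetry t x0 y0 sx sy : symmetry (affine t x0 y0 sx sy).
Proof.
split.
  move=> [[dir x] y] [[dir' x'] y']; rewrite /affine /= => -[/addbI ->].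
  by case: t; case: sx; case: sy => ? ?; congr (_, _, _); lia.
move=> [[dir x] y] [[dir' x'] y']; rewrite /overlap /blk_app /affine /=.
set p' := absz (_ - _); set q' := absz (_ - _).
have [-> ->] : p' = (if t then `|y - y'|%N else `|x - x'|%N) /\
    q' = (if t then `|x - x'|%N else `|y - y'|%N).
  by rewrite /p' /q'; case: (t); case: (sx); case: (sy); lia.
rewrite /overlap_at; move: `|x - x'|%N `|y - y'|%N => p q.
by case: t {p' q'}; case: dir; case: dir' => /=; rewrite // andbC.
Qed.

Definition pair_spec (b c : blk) : Prop :=
  exists s r, [/\ symmetry s, [fset b; c] = [fset s (embed base_block); s (embed r)],
    pair_key b.1.1 c.1.1 `|b.1.2 - c.1.2|%N `|b.2 - c.2|%N = grid_app pair_key base_block r,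
    overlap (embed base_block) (embed r) = overlap b c &
    let '(dir, x, y) := r in (6 <= x)%N && (6 <= y)%N && ~~ (dir && Nat.ltb y x)].

Lemma pair_keyC dir dir' p q : pair_key dir dir' p q = pair_key dir' dir p q.
Proof. by rewrite /pair_key; case: dir; case: dir'. Qed.

Lemma pair_specC b c : pair_spec c b -> pair_spec b c.
Proof.
move=> [s [r [ss E k dir h]]]; exists s, r; split => //; first by rewrite fsetUC E.
- by rewrite distnC pair_keyC (distnC b.2).
- by rewrite dir overlap_sym.
Qed.

Lemma ltbE m n : Nat.ltb m n = (m < n)%N.
Proof. by apply/idP/idP => [/PeanoNat.Nat.ltb_lt|] h; [|apply/PeanoNat.Nat.ltb_lt]; lia. Qed.

Lemma grid_app_base T (f : bool -> bool -> nat -> nat -> T) dir p q :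
  grid_app f base_block (dir, (6 + p)%N, (6 + q)%N) = f false dir p q.
Proof. by rewrite /grid_app /base_block; congr (f _ _ _ _); rewrite !ndistE; lia. Qed.

(** Translation and reflections bring the second block into the upper right quadrant of the first;
    transposition makes an unrotated block the base. A perpendicular pair with [p > q] is transposed
    and its blocks change roles, which gives [p < q]. *)
Lemma pair_specP b c : pair_spec b c.
Proof.
have signed (x x' : int) : exists sx : bool, x + (if sx then - `|x - x'|%N%:Z else `|x - x'|%N%:Z) = x'.
  by exists (x' < x); case: ltP; lia.
have main dir' x y x' y' : (dir' ==> (`|x - x'| <= `|y - y'|)%N) -> pair_spec (false, x, y) (dir', x', y').
  move=> le; have [sx hx] := signed x x'; have [sy hy] := signed y y'.
  exists (affine false x y sx sy), (dir', (6 + `|x - x'|)%N, (6 + `|y - y'|)%N); split.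
  - exact: affine_symmetry.
  - congr [fset _; _]; rewrite /affine /=; congr (_, _, _).
    + by case: (sx); lia.
    + by case: (sy); lia.
    + by rewrite -[LHS]hx; case: (sx); lia.
    + by rewrite -[LHS]hy; case: (sy); lia.
  - by rewrite grid_app_base.
  - by rewrite [LHS]blk_app_embed grid_app_base.
  - by rewrite !leq_addr ltbE /=; move: le; case: (dir') => //=; lia.
have transp x y x' y' : pair_spec (true, x, y) (true, x', y').
  have [sx hx] := signed x x'; have [sy hy] := signed y y'.
  exists (affine true x y sx sy), (false, (6 + `|y - y'|)%N, (6 + `|x - x'|)%N); split.
  - exact: affine_symmetry.
  - congr [fset _; _]; rewrite /affine /=; congr (_, _, _).
    + by case: (sx); lia.
    + by case: (sy); lia.
    + by rewrite -[LHS]hx; case: (sx); lia.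
    + by rewrite -[LHS]hy; case: (sy); lia.
  - by rewrite grid_app_base.
  - by rewrite [LHS]blk_app_embed grid_app_base /overlap /blk_app /overlap_at /= andbC.
  - by rewrite !leq_addr.
have mixed x y x' y' : pair_spec (false, x, y) (true, x', y').
  have [le|lt] := leqP `|x - x'| `|y - y'|; first exact: main.
  have [sx hx] := signed x' x; have [sy hy] := signed y' y.
  exists (affine true x' y' sx sy), (true, (6 + `|y - y'|)%N, (6 + `|x - x'|)%N); split.
  - exact: affine_symmetry.
  - rewrite fsetUC; congr [fset _; _]; rewrite /affine /=; congr (_, _, _).
    + by case: (sx); lia.
    + by case: (sy); lia.
    + by rewrite -[LHS]hx; case: (sx); lia.
    + by rewrite -[LHS]hy; case: (sy); lia.
  - by rewrite grid_app_base /pair_key /= !lebE (ltnW lt) leqNgt lt.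
  - by rewrite [LHS]blk_app_embed grid_app_base /overlap /blk_app /overlap_at /= andbC.
  - by rewrite !leq_addr ltbE /=; lia.
case: b c => [[[] x] y] [[[] x'] y'].
- exact: transp.
- by apply: pair_specC; exact: mixed.
- exact: mixed.
- exact: main.
Qed.

(** * Evaluation of the certificate *)

Lemma check_singleP : Z.leb (Z.mul mu_cube Vsingle) (Z.mul cent (total_joined [:: base_block])).
Proof. by vm_compute. Qed.

Lemma check_joinedP : all check_joined pair_grid.
Proof. by vm_cast_no_check (erefl true). Qed.

Lemma check_pendingP : all check_pending pair_grid.
Proof. by vm_cast_no_check (erefl true). Qed.

Lemma check_linkableP : all check_linkable pair_grid.
Proof. by vm_compute. Qed.

Lemma mem_pair_grid dir x y : (6 <= x <= 12)%N -> (6 <= y <= 12)%N -> (dir, x, y) \in pair_grid.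
Proof.
move=> hx hy; rewrite /pair_grid.
apply: (allpairs_f (fun ox y => (ox, y))); last by rewrite mem_iota; lia.
apply: (allpairs_f (fun dir x => (dir, x))); last by rewrite mem_iota; lia.
by case: dir.
Qed.

Lemma uniq_grid_box : uniq grid_box.
Proof. by vm_compute. Qed.

Lemma eq_sumZ (T : Type) (f g : T -> Z) s : f =1 g -> sumZ f s = sumZ g s.
Proof. by move=> fg; elim: s => //= x s IH; rewrite fg IH. Qed.

Lemma sumZ_map (T T' : Type) (h : T -> T') (f : T' -> Z) s : sumZ f (map h s) = sumZ (f \o h) s.
Proof. by elim: s => //= x s IH; rewrite IH. Qed.

Lemma total_embed U ok cross ok' cross' s :
  (forall d, ok (embed d) = ok' d) -> (forall d d', cross (embed d) (embed d') = cross' d d') ->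
  total blk_app (map embed U) ok cross (map embed s) = total (@grid_app) U ok' cross' s.
Proof.
move=> okE crossE.
have rowE d : pending_weight blk_app (map embed U) (embed d) = pending_weight (@grid_app) U d.
  by rewrite /pending_weight sumZ_map; congr Z.sub; apply: eq_sumZ => x /=; rewrite blk_app_embed.
elim: s => //= d s ->; rewrite rowE okE sumZ_map.
congr (Z.add _ (Z.add (Z.mul _ _) _)); apply: eq_sumZ => x /=.
by rewrite /pair_weight !blk_app_embed okE crossE.
Qed.

Lemma mem_touching_grid S d : d \in touching_grid S -> has (fun c => grid_app overlap_at c d) S.
Proof. by rewrite mem_filter => /andP[]. Qed.

Lemma uniq_touching_grid S : uniq (touching_grid S).
Proof. by rewrite filter_uniq // uniq_grid_box. Qed.

Global Opaque touching_grid total grid_box pair_grid.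

(** * Induction on the number of blocks *)

Section Induction.
Variable R : realFieldType.
Notation ZtoR := (ZtoR R).

Lemma mu_gt0 : 0 < ZtoR mu. Proof. by apply: ZtoR_gt0; vm_compute. Qed.
Lemma cent_gt0 : 0 < ZtoR cent. Proof. by apply: ZtoR_gt0; vm_compute. Qed.
Lemma cent_le_mu : ZtoR cent <= ZtoR mu. Proof. by apply: ZtoR_le; vm_compute. Qed.
Lemma Vmax_gt0 : 0 < ZtoR Vmax. Proof. by apply: ZtoR_gt0; vm_compute. Qed.

Definition rate : R := ZtoR mu / ZtoR cent.

Lemma rate_ge1 : 1 <= rate.
Proof. by rewrite /rate ler_pdivlMr ?cent_gt0 // mul1r cent_le_mu. Qed.

(** The denominator makes every table value times [weight n] at most 1 for [n <= 3], so each base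
    case asks for a single completion. *)
Definition weight (n : nat) : R := rate ^+ n / (rate ^+ 3 * ZtoR Vmax).

Lemma rate_gt0 : 0 < rate. Proof. exact: lt_le_trans rate_ge1. Qed.

Lemma rate_exp_gt0 n : 0 < rate ^+ n.
Proof. exact: exprn_gt0 rate_gt0. Qed.

Lemma weight_den_gt0 : 0 < rate ^+ 3 * ZtoR Vmax.
Proof. exact: mulr_gt0 (rate_exp_gt0 3) Vmax_gt0. Qed.

Lemma weight_gt0 n : 0 < weight n.
Proof. exact: divr_gt0 (rate_exp_gt0 n) weight_den_gt0. Qed.

Lemma weight_le n z : (n <= 3)%N -> Z.le z Vmax -> ZtoR z * weight n <= 1.
Proof.
move=> n3 zV; rewrite /weight mulrA ler_pdivrMr; last exact: weight_den_gt0.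
rewrite mul1r mulrC; apply: le_trans (_ : rate ^+ n * ZtoR Vmax <= _).
  by rewrite (ler_pM2l (rate_exp_gt0 n)) ZtoR_le.
by rewrite (ler_pM2r Vmax_gt0) (ler_weXn2l rate_ge1).
Qed.

Definition claim n : Prop :=
  [/\ forall b, many (good true [fset b] n) (ZtoR Vsingle * weight n),
      forall b c, ~~ overlap b c -> many (good true [fset b; c] n) (ZtoR (blk_app Vjoined b c) * weight n)
    & forall b c, ~~ overlap b c -> many (good false [fset b; c] n) (ZtoR (blk_app Vpending b c) * weight n)].

(** A column of copies of one touching block serves as the completion. *)
Lemma good_conn n S d : touching S d -> exists L, good true S n L.
Proof.
elim: n S => [|n IH] S Sd.
  by exists [::]; split; [exact: glue_nil|by []|rewrite big_nil].
have [L [gL vL sL]] : exists L, good true [fset d] n L.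
  by apply: IH; exists d; rewrite ?inE ?overlap_refl.
exists ([fset d] :: L); split.
- by apply: glue_link1 => //; exact: linked_touching.
- move=> D; rewrite inE => /predU1P[->|/vL//]; split; first exact: nonov1.
  by rewrite -cardfs_gt0 cardfs1.
- by rewrite big_cons sL cardfs1.
Qed.

Lemma good_disc n b c d : overlap b d -> overlap c d -> exists L, good false [fset b; c] n.+1 L.
Proof.
move=> bd cd; have [|L [gL vL sL]] := @good_conn n [fset d] d.
  by exists d; rewrite ?inE ?overlap_refl.
exists ([fset d] :: L); split.
- by apply: glue_link1 => //; apply: linked_all => s /fset2P[]->.
- move=> D; rewrite inE => /predU1P[->|/vL//]; split; first exact: nonov1.
  by rewrite -cardfs_gt0 cardfs1.
- by rewrite big_cons sL cardfs1.
Qed.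

Lemma pair_rep b c (e : bool) n (f : bool -> bool -> nat -> nat -> Z) :
  (forall dir dir' p q dir2 dir2' p2 q2, pair_key dir dir' p q = pair_key dir2 dir2' p2 q2 ->
    f dir dir' p q = f dir2 dir2' p2 q2) ->
  ~~ overlap b c ->
  (forall dir x y, (6 <= x)%N -> (6 <= y)%N -> ~~ (dir && Nat.ltb y x) ->
     ~~ grid_app overlap_at base_block (dir, x, y) ->
     many (good e [fset embed base_block; embed (dir, x, y)] n) (ZtoR (grid_app f base_block (dir, x, y)) * weight n)) ->
  many (good e [fset b; c] n) (ZtoR (blk_app f b c) * weight n).
Proof.
move=> fkey bc H; have [s [[[dir x] y] [ss -> k ovE /andP[/andP[x20 y20] oxy]]]] := pair_specP b c.
have -> : blk_app f b c = grid_app f base_block (dir, x, y) by apply: fkey.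
have -> : [fset s (embed base_block); s (embed (dir, x, y))] = s @` [fset embed base_block; embed (dir, x, y)].
  by rewrite imfsetU !imfset_fset1.
by apply: many_symmetry => //; apply: H; rewrite // -blk_app_embed -/(overlap _ _) ovE.
Qed.

Lemma pair_table_key T F dflt dir dir' p q dir2 dir2' p2 q2 :
  pair_key dir dir' p q = pair_key dir2 dir2' p2 q2 ->
  pair_table T F dflt dir dir' p q = pair_table T F dflt dir2 dir2' p2 q2.
Proof. by rewrite /pair_table => ->. Qed.

Lemma pair_grid_or_far dir x y (f : bool -> bool -> nat -> nat -> Z) z :
  (forall dir dir' p q, (6 < p)%N || (6 < q)%N -> f dir dir' p q = z) ->
  (6 <= x)%N -> (6 <= y)%N -> (dir, x, y) \in pair_grid \/ grid_app f base_block (dir, x, y) = z.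
Proof.
move=> far x20 y20; have [h|h] := boolP ((x <= 12)%N && (y <= 12)%N).
  by left; apply: mem_pair_grid; lia.
by right; rewrite /grid_app /base_block; apply: far; rewrite !ndistE; lia.
Qed.

Lemma claim_base n : (0 < n <= 3)%N -> claim n.
Proof.
move=> /andP[n0 n3]; split.
- move=> b; have [|L gL] := @good_conn n [fset b] b; first by exists b; rewrite ?inE ?overlap_refl.
  by apply: many1 gL _; apply: weight_le => //; vm_compute.
- move=> b c bc; have [|L gL] := @good_conn n [fset b; c] b.
    by exists b; rewrite ?inE ?overlap_refl ?eqxx.
  by apply: many1 gL _; apply: weight_le => //; exact: Vjoined_le.
- move=> b c bc; apply: pair_rep => //; first exact: pair_table_key.
  move=> dir x y x20 y20 _ _.
  have [rr|->] := pair_grid_or_far dir Vpending_far x20 y20; last by apply: many0; rewrite ZtoR0 mul0r.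
  have /orP[/Z.eqb_eq->|/hasP[d _ /andP[ad rd]]] := allP check_linkableP _ rr.
    by apply: many0; rewrite ZtoR0 mul0r.
  have [|//|L gL] := @good_disc n.-1 (embed base_block) (embed (dir, x, y)) (embed d).
  + by rewrite /overlap blk_app_embed.
  + by rewrite /overlap blk_app_embed.
  rewrite prednK // in gL.
  by apply: many1 gL _; apply: weight_le => //; exact: Vpending_le.
Qed.

Lemma weightS n : weight n.+1 = rate * weight n.
Proof. by rewrite /weight exprS mulrA. Qed.

Lemma many_check e (S : layer) m (U : seq blk) (ok : pred blk) (cross : rel blk) (V tot : Z) :
  claim m.+1 -> claim m.+2 -> claim m.+3 ->
  uniq U -> {in U, forall d, touching S d} -> {in U, forall d, ok d -> linked e S d} ->
  {in U &, forall d d', cross d d' -> crossing S d d'} ->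
  total blk_app U ok cross U = tot -> Z.leb (Z.mul mu_cube V) (Z.mul cent tot) ->
  many (good e S m.+4) (ZtoR V * weight m.+4).
Proof.
move=> [c11 c12 c13] [c21 c22 c23] [c31 c32 c33] uU Ut okl crc totE /Z.leb_le/(ZtoR_le R).
rewrite /mu_cube !ZtoRM => le_tot.
have [mu0 cent0] := (mu_gt0, cent_gt0); have cent_neq0 : ZtoR cent != 0 by rewrite lt0r_neq0.
(* Then [cent * cent * w], [mu * cent * w] and [mu * mu * w] are the weights left after a layer of
   three, two and one blocks. *)
pose w := weight m.+1 / (ZtoR cent * ZtoR cent).
have w1 : ZtoR cent * (ZtoR cent * w) = weight m.+1 by rewrite /w; field.
have w2 : ZtoR mu * (ZtoR cent * w) = weight m.+2 by rewrite weightS -w1 /rate; field.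
have w3 : ZtoR mu * (ZtoR mu * w) = weight m.+3 by rewrite weightS -w2 /rate; field.
have w0 : 0 <= w by apply: ltW; apply: divr_gt0; [exact: weight_gt0|exact: mulr_gt0].
have : many (good e S m.+4) (ZtoR (total blk_app U ok cross U) * w).
  apply: many_step => //.
  - by move=> d; rewrite w3 subn1.
  - by move=> d d' dd'; rewrite w2 subn2; exact: c22.
  - by move=> d d' dd'; rewrite w2 subn2; exact: c23.
  - by move=> d d' dd'; rewrite w1; exact: c13.
apply: many_le => //; rewrite totE weightS -w3 /rate.
rewrite [leLHS](_ : _ = (ZtoR mu * (ZtoR mu * ZtoR mu) * ZtoR V) * (w / ZtoR cent)); last by field.
rewrite [leRHS](_ : _ = (ZtoR cent * ZtoR tot) * (w / ZtoR cent)); last by field.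
by apply: ler_wpM2r => //; apply: divr_ge0 => //; exact: ltW.
Qed.

Lemma claim_step m : claim m.+1 -> claim m.+2 -> claim m.+3 -> claim m.+4.
Proof.
move=> c1 c2 c3.
have uU S : uniq [seq embed b | b <- touching_grid S].
  by rewrite (map_inj_uniq embed_inj) uniq_touching_grid.
have touch (S : seq grid_block) (SL : layer) : {in S, forall c, embed c \in SL} ->
    {in [seq embed b | b <- touching_grid S], forall d, touching SL d}.
  move=> SSL _ /mapP[d /mem_touching_grid/hasP[c cS cd] ->].
  by exists (embed c); [exact: SSL|rewrite /overlap blk_app_embed].
have single : many (good true [fset embed base_block] m.+4) (ZtoR Vsingle * weight m.+4).
  have tch := touch [:: base_block] [fset embed base_block].
  apply: (many_check c1 c2 c3 (uU [:: base_block]) (ok := xpredT) (cross := fun _ _ => false)) check_singleP => //.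
  - by apply: tch => c; rewrite !inE => /eqP->.
  - by move=> d dU _; apply: linked_touching; apply: tch dU => c; rewrite !inE => /eqP->.
split.
- move=> b; have [s [r [ss E _ _ _]]] := pair_specP b b.
  have sb : s (embed base_block) = b.
    have : s (embed base_block) \in [fset b; b] by rewrite E !inE eqxx.
    by rewrite !inE orbb => /eqP.
  by have := many_symmetry ss single; rewrite imfset_fset1 sb.
- move=> b c bc; apply: pair_rep => //; first exact: pair_table_key.
  move=> dir x y x20 y20 oxy ar.
  have [rr|->] := pair_grid_or_far dir Vjoined_far x20 y20; last first.
    (* A far pair has the value of a single block, and every continuation of the base block alone
       also serves the pair. *)
    apply: many_le (single) => // L [gL vL sL]; split => //.
    by apply: glue_mono gL; [apply/fsubsetP => z; rewrite !inE => ->|exists (embed base_block); rewrite inE].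
  move/allP: check_joinedP => /(_ _ rr); rewrite /check_joined (negPf ar) (negPf oxy) /=.
  set r := (dir, x, y) => chk.
  have tch : {in [seq embed b | b <- touching_grid [:: base_block; r]],
    forall d, touching [fset embed base_block; embed r] d}.
    by apply: touch => d; rewrite !inE => /orP[]/eqP->; rewrite eqxx ?orbT.
  apply: (many_check c1 c2 c3 (uU [:: base_block; r]) (ok := xpredT) (cross := fun _ _ => false)) chk => //.
  - by move=> d dU _; apply: linked_touching; exact: tch.
  - exact: (@total_embed (touching_grid [:: base_block; r]) xpredT (fun _ _ => false) xpredT (fun _ _ => false)).
- move=> b c bc; apply: pair_rep => //; first exact: pair_table_key.
  move=> dir x y x20 y20 oxy ar.
  have [rr|->] := pair_grid_or_far dir Vpending_far x20 y20; last by apply: many0; rewrite ZtoR0 mul0r.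
  move/allP: check_pendingP => /(_ _ rr); rewrite /check_pending (negPf oxy) orbF.
  set r := (dir, x, y) => /orP[/Z.eqb_eq->|chk]; first by apply: many0; rewrite ZtoR0 mul0r.
  have tch : {in [seq embed b | b <- touching_grid [:: base_block; r]],
    forall d, touching [fset embed base_block; embed r] d}.
    by apply: touch => d; rewrite !inE => /orP[]/eqP->; rewrite eqxx ?orbT.
  apply: (many_check c1 c2 c3 (uU [:: base_block; r]) (ok := fun d => overlap (embed base_block) d && overlap (embed r) d)
    (cross := fun d d' => xorb (overlap (embed base_block) d) (overlap (embed base_block) d'))) chk => //.
  - by move=> d dU /andP[ad rd]; apply: linked_all => s /fset2P[]->.
  (* Both blocks touch the pair and exactly one of them touches the base block, so the other one
     touches [r]. *)
  - move=> d d' /tch[s] /fset2P[]-> sd /tch[s'] /fset2P[]-> s'd' x1 t /fset2P[]->;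
    move: sd s'd' x1; case: (overlap (embed base_block) d); case: (overlap (embed base_block) d') => //; by auto.
  - by apply: total_embed => *; rewrite /overlap !blk_app_embed.
Qed.

Lemma claim_all n : (0 < n)%N -> claim n.
Proof.
elim/ltn_ind: n => n IH n0; have [n3|n3] := leqP n 3; first by apply: claim_base; rewrite n0.
case: n n3 IH {n0} => [|[|[|[|m]]]] // _ IH.
by apply: claim_step; apply: IH => //; rewrite !ltnS ?leqW // leqW //.
Qed.
End Induction.

(** * Blocks and motions of space *)

(** The centre of the projection, integral because both side lengths are even. *)
Definition flat (b : block) : blk :=
  (block_rotated b, block_x b + (if block_rotated b then 2 else 1),
   block_y b + (if block_rotated b then 1 else 2)).

Definition link (b c : block) : bool := (`|block_z b - block_z c| == 1) && overlap (flat b) (flat c).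

Lemma overlap_flat b c : overlap (flat b) (flat c) =
  [&& block_x b < block_x c + block_lx c, block_x c < block_x b + block_lx b,
      block_y b < block_y c + block_ly c & block_y c < block_y b + block_ly b].
Proof.
move: b c => [ [[d x] y] z] [ [[d' x'] y'] z'].
rewrite /overlap /blk_app /overlap_at /flat /block_lx /block_ly /block_x /block_y /block_rotated /=.
by rewrite !lebE; case: d; case: d' => /=; lia.
Qed.

(** * Interiors, attachment and connectedness in combinatorial terms *)

Section Geometry.
Local Open Scope classical_set_scope.
Local Open Scope ring_scope.
Variable R : realType.

Lemma interiorX (T U : topologicalType) (A : set T) (B : set U) :
  interior (A `*` B) = interior A `*` interior B.
Proof.
apply/predeqP => -[x y]; split.
  move=> [[P Q] /= [Px Qy] sub]; split => /=.
    by apply: filterS Px => t Pt; have [] := sub (t, y) (conj Pt (nbhs_singleton Qy)).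
  by apply: filterS Qy => t Qt; have [] := sub (x, t) (conj (nbhs_singleton Px) Qt).
by move=> [/= Ax By]; exists (A, B).
Qed.

Lemma itv_meet (a1 b1 a2 b2 : int) : a1 < b1 -> a2 < b2 ->
  ((`]a1%:~R, b1%:~R[ `&` `]a2%:~R, b2%:~R[)%classic : set R) !=set0 <-> (a1 < b2) && (a2 < b1).
Proof.
move=> h1 h2; split.
  move=> [r /=]; rewrite !in_itv /= => -[/andP[x1 x2] /andP[x3 x4]].
  by rewrite -!(ltr_int R) (lt_trans x1 x4) (lt_trans x3 x2).
(* The endpoints are integers, so half a unit past the larger left end is inside both intervals. *)
move=> /andP[h3 h4]; exists ((Num.max a1 a2)%:~R + 2^-1) => /=.
have half0 : (0 : R) < 2^-1 by lra.
have half1 : (2^-1 : R) < 1 by lra.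
have H (u v w : int) : u <= w -> w < v -> (w%:~R + 2^-1 : R) \in `]u%:~R, v%:~R[.
  move=> uw wv; rewrite in_itv /=; apply/andP; split.
    by rewrite (le_lt_trans (_ : _ <= w%:~R)) ?ler_int // ltrDl.
  have : (w + 1)%:~R <= v%:~R :> R by rewrite ler_int; lia.
  by rewrite intrD; apply: lt_le_trans; rewrite ltrD2l.
by split; apply: H; lia.
Qed.

Lemma lx_gt0 b : 0 < block_lx b. Proof. by rewrite /block_lx; case: ifP. Qed.
Lemma ly_gt0 b : 0 < block_ly b. Proof. by rewrite /block_ly; case: ifP. Qed.

Lemma setX_meet (T U : Type) (A A' : set T) (B B' : set U) :
  (A `*` B `&` (A' `*` B')) !=set0 <-> (A `&` A') !=set0 /\ (B `&` B') !=set0.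
Proof.
split; first by move=> [[x y] [[/= ? ?] [/= ? ?]]]; split; [exists x|exists y].
by move=> [[x [? ?]] [y [? ?]]]; exists (x, y).
Qed.

Lemma attachedE b c : attached R b c <-> link b c.
Proof.
have fstE d : fst @` @body R d = `[(block_x d)%:~R, (block_x d + block_lx d)%:~R]
   `*` `[(block_y d)%:~R, (block_y d + block_ly d)%:~R].
  apply/predeqP => p; split; first by move=> [q [? _] <-].
  move=> pd; exists (p, (block_z d)%:~R) => //; split => //=.
  by rewrite in_itv /= lexx ler_int lerDl.
have meet : interior ((fst @` @body R b) `&` (fst @` @body R c)) !=set0 <-> overlap (flat b) (flat c).
  rewrite !fstE interiorI !interiorX !interior_itv_bnd setX_meet.
  have [lb lc] := (lx_gt0 b, lx_gt0 c); have [mb mc] := (ly_gt0 b, ly_gt0 c).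
  rewrite !itv_meet ?ltrDl // overlap_flat; split.
    by move=> [/andP[-> ->] /andP[-> ->]].
  by move=> /and4P[-> -> -> ->].
by rewrite /attached /link meet; split => [[/eqP-> ->]//|/andP[/eqP-> ->]].
Qed.

Lemma disjointE b c : interior (@body R b) `&` interior (@body R c) = set0 <->
  ~~ ((block_z b == block_z c) && overlap (flat b) (flat c)).
Proof.
have meet : interior (@body R b) `&` interior (@body R c) !=set0 <->
    (block_z b == block_z c) && overlap (flat b) (flat c).
  rewrite !interiorX !interior_itv_bnd !setX_meet.
  have [lb lc] := (lx_gt0 b, lx_gt0 c); have [mb mc] := (ly_gt0 b, ly_gt0 c).
  rewrite !itv_meet ?ltrDl // overlap_flat; split.
    by move=> [[/andP[-> ->] /andP[-> ->]] h]; rewrite !andbT; apply/eqP; lia.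
  by move=> /andP[/eqP h /and4P[-> -> -> ->]]; split => //; lia.
split=> [e|/negP nov].
  by apply/negP => /meet; rewrite e => -[].
by apply/eqP/negPn/negP => /set0P/meet.
Qed.

Definition blocks_disjoint (B : {fset block}) : Prop :=
  {in B &, forall b c, block_z b = block_z c -> overlap (flat b) (flat c) -> b = c}.

Lemma is_buildingE B : is_building R B <-> blocks_disjoint B.
Proof.
split=> H b c bB cB.
  move=> bc o; apply/eqP/negPn/negP => nbc.
  by have /disjointE := H b c bB cB nbc; rewrite bc eqxx o.
move=> nbc; apply/disjointE/negP => /andP[/eqP bc o].
by rewrite (H b c bB cB bc o) eqxx in nbc.
Qed.

Definition block_connected (B : {fset block}) : Prop :=
  forall Q : block -> block -> Prop, equivalent Q ->
  {in B &, forall b c, link b c -> Q b c} -> {in B &, forall b c, Q b c}.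

Lemma link_sym b c : link b c = link c b.
Proof. by rewrite /link distrC overlap_sym. Qed.

Lemma contiguousE B : contiguous R B <-> block_connected B.
Proof.
pose e (u v : B) := `[< attached R (val u) (val v) >].
have eE u v : e u v = link (val u) (val v).
  by apply/asboolP/idP => /attachedE.
have esym : connect_sym e.
  by apply: sym_connect_sym => u v; rewrite !eE link_sym.
split.
  move=> H Q [rQ sQ tQ] lQ b c bB cB.
  have /connectP[p pp pc] : connect e [` bB] [` cB] by exact: H.
  have -> : c = val [` cB] by [].
  have -> : b = val [` bB] by [].
  rewrite {}pc.
  elim: p [` bB] pp => //= x p IH u /andP[ux /IH]; apply: tQ.
  by apply: lQ; rewrite -?eE // fsvalP.
move=> H b c.
(* Equality is added to make [Q] reflexive on blocks outside [B]. *)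
pose Q (x y : block) := x = y \/ exists (u v : B), [/\ x = val u, y = val v & connect e u v].
have [| |bc|[u [v [bu cv uv]]]] := H Q _ _ (val b) (val c) (fsvalP b) (fsvalP c).
- split; first by move=> x; left.
  + by move=> x y [->|[u [v [-> -> uv]]]]; [left|right; exists v, u; rewrite esym].
  + move=> x y z [->//|[u [v [-> -> uv]]]] [<-|[u' [v' [/val_inj vu' -> uv']]]].
      by right; exists u, v.
    by right; exists u, v'; split => //; apply: connect_trans uv _; rewrite vu'.
- move=> x y xB yB xy; right; exists [` xB], [` yB]; split => //.
  by apply: connect1; rewrite eE.
- by rewrite (val_inj bc); exact: connect0.
- by rewrite (val_inj bu) (val_inj cv).
Qed.
End Geometry.

(** * Motions acting on blocks *)

Section Motions.
Local Open Scope classical_set_scope.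
Local Open Scope ring_scope.
Variable R : realType.
Notation point := (R * R * R)%type.
Notation body := (@body R).
Implicit Types (p q v w : point) (f g : point -> point).

Definition rot p : point := (- p.1.2, p.1.1, p.2).

Lemma rotD p q : rot (p + q) = rot p + rot q.
Proof. by rewrite /rot /= opprD. Qed.

Lemma iter_rotD k p q : iter k rot (p + q) = iter k rot p + iter k rot q.
Proof. by elim: k => //= k ->; rewrite rotD. Qed.

Lemma iter_rot_z k p : (iter k rot p).2 = p.2.
Proof. by elim: k. Qed.

Lemma iter_rot4 p : iter 4 rot p = p.
Proof. by case: p => [[x y] z]; rewrite /= /rot /= !opprK. Qed.

Lemma iter_rot_mod k p : iter (k %% 4) rot p = iter k rot p.
Proof.
rewrite {2}(divn_eq k 4) addnC iterD; congr iter.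
by elim: (k %/ 4)%N => // m IH; rewrite mulSn iterD -IH iter_rot4.
Qed.

Lemma motion_form f : motion f -> exists k v, forall p, f p = iter k rot p + v.
Proof.
elim=> [v|a k|{}f g _ [k [v fE]] _ [l [w gE]]].
- by exists 0%N, v.
- exists k; elim: k => [|k [v IH]]; first by exists 0 => p; rewrite addr0.
  (* A quarter turn about [a] is [rot] followed by the translation by
     [(a.1 + a.2, a.2 - a.1, 0)]. *)
  exists (rot v + (a.1 + a.2, a.2 - a.1, 0)) => p.
  rewrite iterS IH iterS addrA -rotD.
  move: (iter k rot p + v) => [[x y] z]; rewrite /quarter_turn /rot /=.
  by congr (_, _, _); rewrite ?addr0 /=; lra.
- exists (k + l)%N, (iter k rot w + v) => p.
  by rewrite /= fE gE iter_rotD addrA iterD.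
Qed.

Lemma in_body b p : body b p <->
  [/\ (block_x b)%:~R <= p.1.1 <= (block_x b + block_lx b)%:~R,
      (block_y b)%:~R <= p.1.2 <= (block_y b + block_ly b)%:~R
    & (block_z b)%:~R <= p.2 <= (block_z b + 1)%:~R].
Proof.
rewrite /Defs.body /=; split; first by move=> [[]]; rewrite !in_itv.
by move=> [h1 h2 h3]; rewrite !in_itv.
Qed.

Definition low b : point := ((block_x b)%:~R, (block_y b)%:~R, (block_z b)%:~R).

Lemma low_body b : body b (low b).
Proof.
have [l m] := (lx_gt0 b, ly_gt0 b).
by apply/in_body; rewrite /low /= !lexx !ler_int !lerDl ltW // ltW.
Qed.

(** The lower corner gives the coordinates, and the extent along the x-axis, 2 or 4, gives the
    orientation. *)
Lemma body_inj : injective body.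
Proof.
have sub b c : body b = body c -> [/\ block_x c <= block_x b, block_y c <= block_y b,
    block_z c <= block_z b & block_x b + block_lx b <= block_x c + block_lx c].
  move=> bc; have := low_body b; rewrite bc => /in_body[/= /andP[]].
  rewrite !ler_int => h1 _ /andP[h2 _] /andP[h3 _].
  split => //.
  have : body b ((block_x b + block_lx b)%:~R, (block_y b)%:~R, (block_z b)%:~R).
    have [l m] := (lx_gt0 b, ly_gt0 b).
    by apply/in_body; rewrite /= !lexx !ler_int !lerDl ltW // ltW.
  by rewrite bc => /in_body[/= /andP[_]]; rewrite ler_int.
move=> b c bc; have [h1 h2 h3 h4] := sub _ _ bc; have [h5 h6 h7 h8] := sub _ _ (esym bc).
move: h1 h2 h3 h4 h5 h6 h7 h8.
case: b {bc} => [[[d x] y] z]; case: c => [[[d' x'] y'] z'].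
rewrite /block_lx /block_x /block_y /block_z /block_rotated /= => h1 h2 h3 h4 h5 h6 h7 h8.
have [-> -> ->] : [/\ x = x', y = y' & z = z'] by split; lia.
by congr (_, _, _, _); case: d d' h4 h8 => -[] //=; lia.
Qed.

Lemma translate_body b v : (fun p => p + v) @` body b = body b -> v = 0.
Proof.
move=> E.
have le_low p : body b p -> [/\ (low b).1.1 <= p.1.1, (low b).1.2 <= p.1.2 & (low b).2 <= p.2].
  by move=> /in_body[/andP[? _] /andP[? _] /andP[? _]].
have [h1 h2 h3] : [/\ 0 <= v.1.1, 0 <= v.1.2 & 0 <= v.2].
  have /le_low : body b (low b + v) by rewrite -E; exists (low b) => //; exact: low_body.
  by rewrite /= !lerDl.
have := low_body b; rewrite -{1}E => -[p /le_low[h4 h5 h6] pv].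
move: h4 h5 h6; rewrite -pv /= !gerDl => h4 h5 h6.
case: v {E pv} h1 h2 h3 h4 h5 h6 => [[x y] z] /= *.
by congr (_, _, _); apply: le_anti; apply/andP.
Qed.

Definition moved f b c : Prop := f @` body b = body c.

Lemma moved_z k v f b c : (forall p, f p = iter k rot p + v) -> moved f b c ->
  (block_z c)%:~R = (block_z b)%:~R + v.2 :> R.
Proof.
move=> fE bc; apply: le_anti; apply/andP; split.
  have : body c (f (low b)) by rewrite -bc; exists (low b) => //; exact: low_body.
  by move=> /in_body[_ _ /andP[h _]]; move: h; rewrite fE /= iter_rot_z.
have := low_body c; rewrite -bc => -[p /in_body[_ _ /andP[h _]] /(congr1 snd)].
by rewrite fE /= iter_rot_z => <-; rewrite lerD2r.
Qed.

Definition matches f (B C : {fset block}) : Prop :=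
  [set f @` body b | b in [set` B]] = [set body c | c in [set` C]].

Lemma matches_fwd f B C b : matches f B C -> b \in B -> exists2 c, c \in C & moved f b c.
Proof.
move=> E bB; have : [set f @` body b | b in [set` B]] (f @` body b) by exists b.
by rewrite E => -[c cC bc]; exists c.
Qed.

Lemma matches_bwd f B C c : matches f B C -> c \in C -> exists2 b, b \in B & moved f b c.
Proof.
move=> E cC; have : [set body c | c in [set` C]] (body c) by exists c.
by rewrite -E => -[b bB bc]; exists b.
Qed.

Lemma matchesP f B C : (forall b, b \in B -> exists2 c, c \in C & moved f b c) ->
  (forall c, c \in C -> exists2 b, b \in B & moved f b c) -> matches f B C.
Proof.
move=> H1 H2; apply/predeqP => X; split.
  by move=> [b /H1[c cC bc] <-]; exists c.
by move=> [c /H2[b bB bc] <-]; exists b.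
Qed.

Lemma moved_inj f b c c' : moved f b c -> moved f b c' -> c = c'.
Proof. by move=> bc bc'; apply: body_inj; rewrite -bc -bc'. Qed.

Lemma form_inj k v f : (forall p, f p = iter k rot p + v) -> injective f.
Proof.
have rotI : injective rot.
  by move=> [[x y] z] [[x' y'] z'] [yy -> ->]; congr (_, _, _); exact: oppr_inj yy.
by move=> fE p q; rewrite !fE => /addIr; elim: k {fE} => //= k IH /rotI/IH.
Qed.

Lemma motion_inj f : motion f -> injective f.
Proof. by move=> /motion_form[k [v]]; exact: form_inj. Qed.

Lemma moved_inv f b b' c : motion f -> moved f b c -> moved f b' c -> b = b'.
Proof.
move=> /motion_inj fI bc b'c; apply: body_inj; apply/predeqP => p.
have sub d d' : moved f d c -> moved f d' c -> body d p -> body d' p.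
  move=> dc d'c dp; have : body c (f p) by rewrite -dc; exists p.
  by rewrite -d'c => -[q d'q /fI <-].
by split; exact: sub.
Qed.

Lemma identified_refl B : identified R B B.
Proof.
exists (translation 0); first exact: motion_translation.
apply: matchesP => b bB; exists b => //; rewrite /moved.
all: by apply/predeqP => p; split => [[q bq <-]|bp]; [rewrite /translation addr0|exists p; rewrite // /translation addr0].
Qed.

Lemma matches_comp f g A B C : matches f A B -> matches g B C -> matches (g \o f) A C.
Proof.
move=> fAB gBC; apply: matchesP.
  move=> a /(matches_fwd fAB)[b bB ab]; have [c cC bc] := matches_fwd gBC bB.
  by exists c; rewrite // /moved -image_comp ab.
move=> c /(matches_bwd gBC)[b bB bc]; have [a aA ab] := matches_bwd fAB bB.
by exists a; rewrite // /moved -image_comp ab.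
Qed.

Lemma identified_trans A B C : identified R A B -> identified R B C -> identified R A C.
Proof.
move=> [f mf fAB] [g mg gBC]; exists (g \o f); first exact: motion_comp.
exact: matches_comp fAB gBC.
Qed.

Lemma motion_inverse f : motion f -> exists2 g, motion g & cancel f g.
Proof.
elim=> [v|a k|{}f g _ [f' mf' ff'] _ [g' mg' gg']].
- exists (translation (- v)); first exact: motion_translation.
  by move=> p; rewrite /translation addrK.
- exists (iter (k * 3) (quarter_turn a)); first exact: motion_rotation.
  have q4 p : iter 4 (quarter_turn a) p = p.
    by case: p => [[x y] z]; rewrite /quarter_turn /=; congr (_, _, _); lra.
  by move=> p; rewrite -iterD addnC -mulnS; elim: k => // k IH; rewrite mulSn iterD q4 IH.
- exists (g' \o f'); first exact: motion_comp.
  by move=> p /=; rewrite ff' gg'.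
Qed.

Lemma identified_sym B C : identified R B C -> identified R C B.
Proof.
move=> [f mf fBC]; have [g mg fg] := motion_inverse mf; exists g => //.
have inv b c : moved f b c -> moved g c b.
  rewrite /moved => <-; rewrite image_comp; apply/predeqP => p; split.
    by move=> [q bq <-]; rewrite /= fg.
  by move=> bp; exists p; rewrite //= fg.
apply: matchesP => [c /(matches_bwd fBC)[b bB bc]|b /(matches_fwd fBC)[c cC bc]].
  by exists b => //; exact: inv.
by exists c => //; exact: inv.
Qed.
End Motions.

(** * Stacks of layers as buildings *)

Definition put (k : nat) (b : blk) : block :=
  (b.1.1, b.1.2 - (if b.1.1 then 2 else 1), b.2 - (if b.1.1 then 1 else 2), k%:Z).

Lemma flat_put k b : flat (put k b) = b.
Proof.
by case: b => [[d x] y]; rewrite /flat /put /block_rotated /block_x /block_y /= !subrK.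
Qed.

Lemma put_flat b k : block_z b = k%:Z -> put k (flat b) = b.
Proof.
move: b => [[[d x] y] z]; rewrite /block_z /flat /put /block_rotated /block_x /block_y /= => ->.
by rewrite !addrK.
Qed.

Lemma put_inj k : injective (put k).
Proof. exact: can_inj (flat_put k). Qed.

Fixpoint tower (k : nat) (L : seq layer) : {fset block} :=
  if L is D :: L' then ((put k @` D) `|` tower k.+1 L')%fset else fset0.

Lemma mem_tower k L x : (x \in tower k L) = (0 <= block_z x) && inL k L (`|block_z x|%N, flat x).
Proof.
elim: L k => [|D L IH] k /=; first by rewrite inE andbF.
rewrite !inE IH; have [x0|x0] := boolP (0 <= block_z x); last first.
  rewrite orbF; apply/negbTE; apply: contraNN x0 => /imfsetP[b _ ->] //.
congr (_ || _); apply/imfsetP/andP.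
  by move=> [b /= bD ->]; rewrite flat_put /block_z /=.
move=> [/eqP zk xD]; exists (flat x) => //; rewrite put_flat //.
by rewrite -zk gez0_abs.
Qed.

Lemma mem_tower_put k L i b : (put i b \in tower k L) = inL k L (i, b).
Proof. by rewrite mem_tower flat_put. Qed.

Lemma inL_ge k L i b : inL k L (i, b) -> (k <= i)%N.
Proof.
elim: L k => //= D L IH k /orP[/andP[/eqP-> _]//|/IH]; exact: ltnW.
Qed.

Lemma inL_hd k D L b : inL k (D :: L) (k, b) = (b \in D).
Proof.
rewrite /= eqxx /=; case: (boolP (b \in D)) => //= _; apply/negbTE/negP => /inL_ge.
by rewrite ltnn.
Qed.

Lemma inL_tl k D L i b : (k < i)%N -> inL k (D :: L) (i, b) = inL k.+1 L (i, b).
Proof. by move=> ki; rewrite /= gtn_eqF. Qed.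

(** Empty layers at the top would leave no mark in the set of blocks; without them the list can be
    read off level by level. *)
Lemma inL_inj k L L' : (forall D, D \in L -> D != fset0) -> (forall D, D \in L' -> D != fset0) ->
  (forall i b, inL k L (i, b) = inL k L' (i, b)) -> L = L'.
Proof.
elim: L k L' => [|D L IH] k [|D' L'] // h h' E.
- have /fset0Pn[b bD] := h' D' (mem_head _ _).
  by have := E k b; rewrite inL_hd bD.
- have /fset0Pn[b bD] := h D (mem_head _ _).
  by have := E k b; rewrite inL_hd bD.
congr (_ :: _); first by apply/fsetP => b; have := E k b; rewrite !inL_hd.
apply: (IH k.+1).
- by move=> A AL; apply: h; rewrite inE AL orbT.
- by move=> A AL; apply: h'; rewrite inE AL orbT.
move=> i b; have [ki|ik] := ltnP k i; first by rewrite -(inL_tl D) // E inL_tl.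
by apply/idP/idP => /inL_ge; rewrite ltnNge ik.
Qed.

Lemma card_tower k L : #|` tower k L| = (\sum_(D <- L) #|` D|)%N.
Proof.
elim: L k => [|D L IH] k; first by rewrite big_nil cardfs0.
rewrite big_cons -(IH k.+1) /= cardfsU card_imfset /=; last exact: put_inj.
have -> : ((put k @` D) `&` tower k.+1 L)%fset = fset0.
  apply/eqP/fset0Pn => -[x]; rewrite inE => /andP[/imfsetP[b _ ->]].
  by rewrite mem_tower_put => /inL_ge; rewrite ltnn.
by rewrite cardfs0 subn0.
Qed.

Lemma inL_nonov k L i b c : (forall D, D \in L -> nonov D) ->
  inL k L (i, b) -> inL k L (i, c) -> overlap b c -> b = c.
Proof.
elim: L k => // D L IH k h.
have [->|ki] := eqVneq i k; first by rewrite !inL_hd; apply: h; rewrite mem_head.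
move=> ib; have : (k < i)%N by rewrite ltn_neqAle eq_sym ki (inL_ge ib).
move=> lt; move: ib; rewrite !inL_tl //; apply: IH => A AL.
by apply: h; rewrite inE AL orbT.
Qed.

Section Towers.
Variable R : realType.

Definition tower_on (b : blk) (L : seq layer) : {fset block} := tower 0 ([fset b] :: L).

Lemma block_putE x : 0 <= block_z x -> x = put `|block_z x| (flat x).
Proof. by move=> x0; rewrite put_flat // gez0_abs. Qed.

Lemma tower_on_building b n L : good true [fset b] n L ->
  contiguous_buildings R n.+1 (tower_on b L).
Proof.
move=> [gL vL sL]; split.
- apply/is_buildingE => x y; rewrite !mem_tower => /andP[x0 xL] /andP[y0 yL] xy o.
  rewrite (block_putE x0) (block_putE y0) xy; congr put.
  apply: (@inL_nonov 0 ([fset b] :: L) `|block_z x|) => //; last by rewrite xy.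
  by move=> D; rewrite inE => /predU1P[->|/vL[]//] c d /fset1P-> /fset1P->.
- apply/contiguousE => Q [rQ sQ tQ] lQ x y; rewrite !mem_tower => /andP[x0 xL] /andP[y0 yL].
  rewrite (block_putE x0) (block_putE y0).
  have := gL 0%N (fun p q => Q (put p.1 p.2) (put q.1 q.2)) _ _ _ _ _ xL yL; apply.
  + by split => *; eauto.
  + move=> [i c] [j d] ic jd /andP[/= ij cd]; apply: lQ; rewrite ?mem_tower_put //.
    rewrite /link !flat_put cd andbT /block_z /=.
    by case/orP: ij => /eqP ->; apply/eqP; lia.
  + by move=> _ c d /fset1P-> /fset1P->.
- by rewrite card_tower big_cons cardfs1 sL.
Qed.

Lemma tower_on_inj b n n' L L' : good true [fset b] n L -> good true [fset b] n' L' ->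
  tower_on b L = tower_on b L' -> L = L'.
Proof.
move=> [_ vL _] [_ vL' _] E.
have : [fset b] :: L = [fset b] :: L'.
  apply: (@inL_inj 0).
  - by move=> D; rewrite inE => /predU1P[->|/vL[]//]; rewrite -cardfs_gt0 cardfs1.
  - by move=> D; rewrite inE => /predU1P[->|/vL'[]//]; rewrite -cardfs_gt0 cardfs1.
  - by move=> i c; rewrite -!mem_tower_put -/(tower_on b L) E.
by case.
Qed.

Lemma tower_on_bottom b L x : x \in tower_on b L -> block_z x = 0 -> x = put 0 b.
Proof.
rewrite mem_tower => /andP[x0 xL] xz; rewrite (block_putE x0) xz; congr put.
by move: xL; rewrite xz inL_hd => /fset1P.
Qed.

Lemma bottom_in_tower_on b L : put 0 b \in tower_on b L.
Proof. by rewrite mem_tower_put inL_hd inE. Qed.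

Lemma tower_on_ge0 b L x : x \in tower_on b L -> 0 <= block_z x.
Proof. by rewrite mem_tower => /andP[]. Qed.

(* A motion between two towers on b fixes the bottom block, so its rotation part
   determines it. *)
Lemma tower_on_moved b L L' (f : R * R * R -> R * R * R) : motion f -> matches f (tower_on b L) (tower_on b L') ->
  moved f (put 0 b) (put 0 b).
Proof.
move=> /motion_form[k [v fE]] fLL'.
have [c cL' bc] := matches_fwd fLL' (bottom_in_tower_on b L).
have zc := moved_z fE bc.
have [a aL ab] := matches_bwd fLL' (bottom_in_tower_on b L').
have za := moved_z fE ab.
have base_block := tower_on_ge0 aL; have c0 := tower_on_ge0 cL'.
suff z0 : block_z c = 0 by rewrite -{2}(tower_on_bottom cL' z0).
move: zc za; rewrite /block_z /= -/(block_z a) -/(block_z c) => zc za.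
(* [c] is the image of the bottom block and [a] its preimage: their heights are opposite, and both
   are nonnegative. *)
have : (block_z c + block_z a)%:~R = 0 :> R by rewrite intrD zc za addrC; lra.
by move/eqP; rewrite intr_eq0 => /eqP; lia.
Qed.

Lemma tower_on_rotation b L0 L L' k v v' (f f' : R * R * R -> R * R * R) :
  motion f -> motion f' ->
  (forall p, f p = iter k (@rot R) p + v) -> (forall p, f' p = iter k (@rot R) p + v') ->
  matches f (tower_on b L0) (tower_on b L) -> matches f' (tower_on b L0) (tower_on b L') ->
  tower_on b L = tower_on b L'.
Proof.
move=> mf mf' fE f'E m m'.
have h := tower_on_moved mf m; have h' := tower_on_moved mf' m'.
have vv' : v' = v.
  (* With equal rotation parts the motions differ by a translation, which maps the body of the
     bottom block onto itself. *)
  apply/eqP; rewrite -subr_eq0; apply/eqP; apply: (@translate_body R (put 0 b)).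
  rewrite -{2}h' -{1}h image_comp; congr image; apply/funext => p /=.
  by rewrite fE f'E -addrA [v + _]addrC subrK.
have ff' : f = f' by apply/funext => p; rewrite fE f'E vv'.
subst f'.
apply/fsetP => x; apply/idP/idP => [/(matches_bwd m)|/(matches_bwd m')] -[a base_block ax].
  by have [y yL' ay] := matches_fwd m' base_block; rewrite (moved_inj ax ay).
by have [y yL' ay] := matches_fwd m base_block; rewrite (moved_inj ax ay).
Qed.
End Towers.

Definition slide (t : int * int * int) (b : block) : block :=
  (block_rotated b, block_x b + t.1.1, block_y b + t.1.2, block_z b + t.2).

Lemma slide_inj t : injective (slide t).
Proof.
move=> [[[d x] y] z] [[[d' x'] y'] z'].
by rewrite /slide /block_rotated /block_x /block_y /block_z /= => -[-> /addIr-> /addIr-> /addIr->].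
Qed.

Lemma overlap_slide t b c : overlap (flat (slide t b)) (flat (slide t c)) = overlap (flat b) (flat c).
Proof. by rewrite !overlap_flat /slide /block_lx /block_ly /block_x /block_y /block_rotated /=; lia. Qed.

Lemma link_slide t b c : link (slide t b) (slide t c) = link b c.
Proof. by rewrite /link overlap_slide /slide /block_z /=; congr (_ && _); congr (`|_| == _); ring. Qed.

(** * Bounds on the number of buildings *)

Section Classes.
Variable R : realType.

Definition building_class n B : set {fset block} := [set C | contiguous_buildings R n C /\ identified R B C].

Lemma identified_of_class n B B' : contiguous_buildings R n B' ->
  building_class n B = building_class n B' -> identified R B B'.
Proof.
move=> cB' E; have : building_class n B' B' by split => //; exact: identified_refl.
by rewrite -E => -[].
Qed.

Lemma class_of_identified n B B' : identified R B B' -> building_class n B = building_class n B'.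
Proof.
move=> BB'; apply/predeqP => C; split => -[cC IC]; split => //.
  exact: identified_trans (identified_sym BB') IC.
exact: identified_trans BB' IC.
Qed.

Lemma slide_identified t (B : {fset block}) : identified R B (slide t @` B).
Proof.
exists (translation (t.1.1%:~R, t.1.2%:~R, t.2%:~R)); first exact: motion_translation.
have mv b : moved (translation (t.1.1%:~R, t.1.2%:~R, t.2%:~R) : R * R * R -> _) b (slide t b).
  apply/predeqP => p; split.
    move=> [q /in_body[h1 h2 h3] <-]; apply/in_body.
    by move: h1 h2 h3; rewrite /slide /block_lx /block_ly /block_x /block_y /block_z /block_rotated /=
      !intrD => h1 h2 h3; split; lra.
  move=> /in_body[h1 h2 h3]; exists (p - (t.1.1%:~R, t.1.2%:~R, t.2%:~R)); last by rewrite /translation subrK.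
  apply/in_body; move: h1 h2 h3.
  rewrite /slide /block_lx /block_ly /block_x /block_y /block_z /block_rotated /= !intrD => h1 h2 h3.
  by split; lra.
apply: (@matchesP R) => [b bB|_ /imfsetP[b /= bB ->]].
  by exists (slide t b); [rewrite in_imfset|].
by exists b.
Qed.

Lemma slide_contiguous n t B : contiguous_buildings R n B -> contiguous_buildings R n (slide t @` B).
Proof.
move=> [/is_buildingE dB /contiguousE cB nB]; split.
- apply/is_buildingE => _ _ /imfsetP[b /= bB ->] /imfsetP[c /= cB' ->].
  by rewrite overlap_slide /slide {1 2}/block_z /= => /addIr bc o; rewrite (dB b c).
- apply/contiguousE => Q [rQ sQ tQ] lQ _ _ /imfsetP[b /= bB ->] /imfsetP[c /= cB' ->].
  apply: (cB (fun x y => Q (slide t x) (slide t y))) => //.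
  + by split => *; eauto.
  + by move=> x y xB yB xy; apply: lQ; rewrite ?in_imfset // link_slide.
- by rewrite card_imfset //; exact: slide_inj.
Qed.

(** * Exponential upper bound by walks *)

Definition offsets : seq int := [seq i%:Z - 6 | i <- iota 0 13].

Definition steps : seq (bool * (int * int * int)) :=
  [seq (d, t) | d <- [:: false; true],
     t <- [seq (xy, z) | xy <- [seq (x, y) | x <- offsets, y <- offsets], z <- [:: -1; 0; 1]]].

Definition step_block (s : bool * (int * int * int)) (b : block) : block :=
  let '(_, x, y, z) := slide s.2 b in (s.1, x, y, z).

Lemma mem_offsets (i : int) : (-6 <= i <= 6) -> i \in offsets.
Proof.
by move=> hi; apply/mapP; exists (absz (i + 6)); [rewrite mem_iota; lia|lia].
Qed.

Lemma mem_steps d (x y z : int) : -6 <= x <= 6 -> -6 <= y <= 6 -> -1 <= z <= 1 -> (d, (x, y, z)) \in steps.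
Proof.
move=> hx hy hz; apply: (allpairs_f (fun d t => (d, t))); first by case: d.
apply: (allpairs_f (fun xy z => (xy, z))).
  by apply: (allpairs_f (fun x y => (x, y))); exact: mem_offsets.
by rewrite !inE; lia.
Qed.

Lemma link_step b c : link b c -> exists2 s, s \in steps & step_block s b = c.
Proof.
move=> /andP[/eqP z1]; rewrite overlap_flat => o.
exists (block_rotated c, (block_x c - block_x b, block_y c - block_y b, block_z c - block_z b)).
  move: o; rewrite /block_lx /block_ly => o.
  by apply: mem_steps; case: (block_rotated b) o; case: (block_rotated c); lia.
move: c {z1 o} => [[[d' x'] y'] z'].
by rewrite /step_block /slide /block_x /block_y /block_z /block_rotated /=; congr (_, _, _, _); lia.
Qed.

Local Opaque steps.

(** Pads short walks, so that all of them are encoded by words of one length. *)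
Definition stay b : bool * (int * int * int) := (block_rotated b, (0, 0, 0)).

Lemma step_block_stay b : step_block (stay b) b = b.
Proof. by case: b => [[[d x] y] z]; rewrite /step_block /slide /= !addr0. Qed.

Fixpoint walk (b : block) (w : seq (bool * (int * int * int))) : seq block :=
  if w is s :: w' then step_block s b :: walk (step_block s b) w' else [::].

Fixpoint words (n : nat) : seq (seq (bool * (int * int * int))) :=
  if n is n'.+1 then [seq s :: w | s <- steps, w <- words n'] else [:: [::]].

Lemma size_words n : size (words n) = (size steps ^ n)%N.
Proof. by elim: n => //= n IH; rewrite size_allpairs IH expnS. Qed.

Lemma path_walk b p n : path link b p -> (size p <= n)%N ->
  exists2 w, w \in words n & b :: walk b w =i b :: p.
Proof.
elim: n b p => [|n IH] b [|c p] //=.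
- by move=> _ _; exists [::].
- move=> _ _; have [w wn wE] := IH b [::] isT isT; exists (stay b :: w).
    apply: (allpairs_f cons) => //; apply: mem_steps; lia.
  by move=> x; rewrite [walk _ _]/= step_block_stay in_cons wE !inE orbb.
- move=> /andP[bc pc] pn; have [w wn wE] := IH c p pc pn.
  have [s ss sE] := link_step bc; exists (s :: w); first exact: (allpairs_f cons).
  by move=> x; rewrite /= sE in_cons wE in_cons.
Qed.

(** A new block [t] linked to a visited block [s] is inserted as a detour from [s] to [t] and back.
    Each block after the first thus costs two steps. *)
Lemma connected_walk (B : {fset block}) b m : block_connected B -> b \in B -> (m < #|` B|)%N ->
  exists p, [/\ path link b p, (size p <= m * 2)%N, {subset b :: p <= B}
    & (m < #|` [fset x in b :: p]|)%N].
Proof.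
move=> cB bB; elim: m => [|m IH] mB.
  exists [::]; split => // [x|]; first by rewrite inE => /eqP->.
  by rewrite cardfs_gt0; apply/fset0Pn; exists b; rewrite !inE eqxx.
have [p [pp sp pB mp]] := IH (ltnW mB).
pose S := [fset x in b :: p]; have SB : S `<=` B by apply/fsubsetP => x; rewrite !inE => /pB.
have [E|ne] := eqVneq S B.
  exists p; split => //; first by apply: leq_trans sp _; rewrite leq_mul2r leqnSn.
  by rewrite -/S E.
have [s [t [sS tB tS st]]] : exists s t, [/\ s \in S, t \in B, t \notin S & link s t].
  apply: contrapT => no; case/negP: ne; rewrite eqEfsubset SB /=; apply/fsubsetP => t tB.
  have bS : b \in S by rewrite !inE eqxx.
  (* If no link left [S], linked blocks of [B] would agree on membership in [S], and connectedness
     would make membership constant on [B]. *)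
  have := cB (fun x y => (x \in S) = (y \in S)); rewrite /= => /(_ _ _ b t bB tB).
  rewrite bS => <- //; first by split => // x y z ->.
  have half x y : x \in B -> y \in B -> link x y -> x \in S -> y \in S.
    by move=> xB yB xy xS; apply/negPn/negP => yS; apply: no; exists x, y.
  by move=> x y xB yB xy; apply/idP/idP; apply: half; rewrite // link_sym.
have : s \in b :: p by move: sS; rewrite !inE.
move=> sp'; have [p1 [p2 [pE ls]]] : exists p1 p2, p = p1 ++ p2 /\ last b p1 = s.
  by case/splitPl: sp' => p1 p2 ls; exists p1, p2.
exists (p1 ++ t :: s :: p2); split.
- by move: pp; rewrite pE !cat_path ls /= => /andP[-> ->]; rewrite st link_sym st.
- by move: sp; rewrite pE !size_cat /= !addnS mulSn.
- move=> x; rewrite inE mem_cat !inE => /or3P[/eqP->//|xp1|/or3P[/eqP->//|/eqP->|xp2]].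
  + by apply: pB; rewrite pE inE mem_cat xp1 orbT.
  + exact: (fsubsetP SB).
  + by apply: pB; rewrite pE inE mem_cat xp2 !orbT.
- apply: leq_trans (_ : #|` t |` S| <= _)%N; first by rewrite cardfsU1 tS add1n ltnS.
  apply: fsubset_leq_card; apply/fsubsetP => x; rewrite !inE pE !mem_cat ?inE.
  by case/or3P => [->|->|/orP[]->]; rewrite ?orbT.
Qed.

Definition origin (d : bool) : block := (d, 0, 0, 0).

Definition walks n : seq {fset block} :=
  [seq [fset x in b :: walk b w] | b <- [:: origin false; origin true], w <- words (n * 2)].

Lemma mem_walks n (B : {fset block}) d : block_connected B -> origin d \in B -> #|` B| = n.+1 ->
  B \in walks n.
Proof.
move=> cB bB nB; have [|p [pp sp pB mp]] := @connected_walk B (origin d) n cB bB; first by rewrite nB.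
have [w wn wE] := path_walk pp sp.
have fE x : (x \in [fset x in origin d :: walk (origin d) w]) = (x \in origin d :: p).
  by have := wE x; rewrite !inE.
have -> : B = [fset x in origin d :: walk (origin d) w].
  apply/esym/eqP; rewrite eqEfcard; apply/andP; split.
    by apply/fsubsetP => x; rewrite fE => /pB.
  rewrite nB; apply: leq_trans mp _; apply: fsubset_leq_card; apply/fsubsetP => x.
  by rewrite fE !inE.
apply: (allpairs_f (fun b w => [fset x in b :: walk b w])) => //.
by case: (d); rewrite !inE eqxx ?orbT.
Qed.

(** A translation brings some block of the building to the origin, where the walks start; hence
    there are finitely many classes. *)
Lemma classes_walks n : (building_classes R n.+1 `<=` [set` [seq building_class n.+1 B | B <- walks n]])%classic.
Proof.
move=> _ [B cB <-]; have [dB conB nB] := cB.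
have /fset0Pn[b bB] : B != fset0 by rewrite -cardfs_gt0 nB.
pose t : int * int * int := (- block_x b, - block_y b, - block_z b).
have [_ /contiguousE cB' nB'] := slide_contiguous t cB.
apply/mapP; exists (slide t @` B); last exact/class_of_identified/slide_identified.
apply: (@mem_walks _ _ (block_rotated b)) => //.
by apply/imfsetP; exists b => //; rewrite /slide /= !subrr.
Qed.

Lemma finite_classes n : finite_set (building_classes R n.+1).
Proof. by apply: sub_finite_set (@classes_walks n) _; exact: finite_seq. Qed.

Lemma T24_le n : (T24 R n.+1 <= 2 * size steps ^ (n * 2))%N.
Proof.
have -> : (2 * size steps ^ (n * 2))%N = size [seq building_class n.+1 B | B <- walks n].
  by rewrite size_map [RHS]size_allpairs size_words.
apply: uniq_leq_size; first exact: fset_uniq.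
move=> c; rewrite in_fset_set; last exact: finite_classes.
by rewrite inE => /classes_walks.
Qed.
End Classes.

Lemma block_z_slide t b : block_z (slide t b) = block_z b + t.2.
Proof. by []. Qed.

(** * Towers against classes, and supermultiplicativity *)

Section Super.
Variable R : realType.

Lemma building_class_in n B : contiguous_buildings R n.+1 B ->
  building_class R n.+1 B \in fset_set (building_classes R n.+1).
Proof.
by move=> cB; rewrite in_fset_set ?inE; [exists B|exact: finite_classes].
Qed.

Lemma building_class_rep n c : c \in fset_set (building_classes R n.+1) ->
  exists2 B, contiguous_buildings R n.+1 B & building_class R n.+1 B = c.
Proof.
by rewrite in_fset_set ?inE; [move=> [B cB <-]; exists B|exact: finite_classes].
Qed.

(** A tower is determined by its class and the rotation part, modulo 4, of a motion onto it from a
    chosen tower of that class; hence the factor 4. *)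
Lemma T24_towers b n (s : seq (seq layer)) : uniq s ->
  (forall L, L \in s -> good true [fset b] n L) -> (size s <= T24 R n.+1 * 4)%N.
Proof.
move=> us sg.
pose cl L := building_class R n.+1 (tower_on b L).
pose rep L := nth [::] s (find (fun L' => cl L' == cl L) s).
have hasr L : L \in s -> has (fun L' => cl L' == cl L) s.
  by move=> Ls; apply/hasP; exists L.
have rep_s L : L \in s -> rep L \in s by move=> /hasr; rewrite has_find; exact: mem_nth.
have rep_cl L : L \in s -> cl (rep L) = cl L by move=> /hasr/(nth_find [::])/eqP.
have /choice[k kP] : forall L, exists k : 'I_4, L \in s ->
    exists f v, [/\ motion f, forall p, f p = iter k (@rot R) p + v &
                 matches f (tower_on b (rep L)) (tower_on b L)].
  move=> L; have [Ls|_] := boolP (L \in s); last by exists ord0.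
  have [f mf fm] : identified R (tower_on b (rep L)) (tower_on b L).
    by apply: identified_of_class (rep_cl L Ls); exact/tower_on_building/sg.
  have [k [v fE]] := motion_form mf.
  exists (Ordinal (ltn_pmod k (isT : 0 < 4)%N)) => _; exists f, v; split => // p.
  by rewrite /= iter_rot_mod.
pose g L := (cl L, k L).
have gI : {in s &, injective g}.
  move=> L L' Ls L's [clE kE].
  have repE : rep L = rep L' by rewrite /rep clE.
  have [f [v [mf fE fm]]] := kP L Ls; have [f' [v' [mf' f'E fm']]] := kP L' L's.
  rewrite -kE in f'E; rewrite -repE in fm'.
  exact: tower_on_inj (sg _ Ls) (sg _ L's) (tower_on_rotation mf mf' fE f'E fm fm').
have -> : (T24 R n.+1 * 4)%N =
    size [seq (c, i) | c <- fset_set (building_classes R n.+1), i <- enum 'I_4].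
  by rewrite size_allpairs size_enum_ord.
rewrite -(size_map g); apply: uniq_leq_size; first by rewrite map_inj_in_uniq.
move=> _ /mapP[L Ls ->]; apply: allpairs_f; last by rewrite mem_enum.
exact/building_class_in/tower_on_building/sg.
Qed.

Lemma exists_top (A : {fset block}) : A != fset0 ->
  exists2 a, a \in A & {in A, forall x, block_z x <= block_z a}.
Proof.
move=> /fset0Pn[base_block a0A].
have H (s : seq block) : s != [::] -> exists2 a, a \in s & {in s, forall x, block_z x <= block_z a}.
  elim: s => // x s IH _; case: s IH => [_|y s IH].
    by exists x; rewrite ?inE // => z; rewrite inE => /eqP->.
  have [//|a aS ha] := IH; have [xa|/ltW ax] := leP (block_z x) (block_z a).
    exists a; first by rewrite inE aS orbT.
    by move=> z; rewrite inE => /predU1P[->//|/ha].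
  exists x; first by rewrite inE eqxx.
  by move=> z; rewrite inE => /predU1P[->//|/ha]; move/le_trans; apply.
by apply: (H (enum_fset A)); apply/eqP => e; have : base_block \in enum_fset A by []; rewrite e.
Qed.

Definition below (A B : {fset block}) : Prop := {in A & B, forall a b, block_z a < block_z b}.

(** A lowest block of [B] is centred exactly over a highest block of [A], one level up: equal
    centres overlap whatever the orientations. *)
Lemma stack n m A B : contiguous_buildings R n.+1 A -> contiguous_buildings R m.+1 B ->
  exists B', [/\ identified R B B', below A B' & contiguous_buildings R (n.+1 + m.+1) (A `|` B')].
Proof.
move=> cA cB; have [dA conA nA] := cA; have [_ _ nB] := cB.
have [|a aA amax] := @exists_top A; first by rewrite -cardfs_gt0 nA.
(* A lowest block is obtained as a highest one of the mirror image. *)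
have [|b0 b0B b0max] := @exists_top ((fun b => (block_rotated b, block_x b, block_y b, - block_z b)) @` B).
  by rewrite -cardfs_gt0; have /fset0Pn[b bB] : B != fset0 by [rewrite -cardfs_gt0 nB];
     rewrite cardfs_gt0; apply/fset0Pn; exists (block_rotated b, block_x b, block_y b, - block_z b);
     exact: in_imfset.
have /imfsetP[b /= bB b0E] := b0B.
have bmin : {in B, forall x, block_z b <= block_z x}.
  move=> x xB; have := b0max _ (in_imfset _ (fun b => (block_rotated b, block_x b, block_y b, - block_z b)) xB).
  by rewrite b0E /block_z /= lerN2.
pose t : int * int * int := ((flat a).1.2 - (flat b).1.2, (flat a).2 - (flat b).2, block_z a + 1 - block_z b).
have AB : below A (slide t @` B).
  move=> x _ xA /imfsetP[y /= yB ->]; have := amax x xA; have := bmin y yB.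
  by rewrite block_z_slide /=; lia.
have cB' := slide_contiguous t cB; have [dB' conB' nB'] := cB'.
exists (slide t @` B); split => //; first exact: slide_identified.
have ab : link a (slide t b).
  apply/andP; split; first by rewrite block_z_slide /=; apply/eqP; lia.
  rewrite /overlap /blk_app /flat /slide /block_rotated /block_x /block_y /=.
  rewrite /t /flat /block_rotated /block_x /block_y /=.
  set p := absz _; set q := absz _.
  have [-> ->] : p = 0%N /\ q = 0%N by rewrite /p /q; split; lia.
  by case: b.1.1.1; case: a.1.1.1.
split.
- move/is_buildingE: dA => dA; move/is_buildingE: dB' => dB'.
  apply/is_buildingE => x y; rewrite !in_fsetU => /orP[xA|xB] /orP[yA|yB] xy.
  + exact: dA.
  + by have := AB _ _ xA yB; rewrite xy ltxx.
  + by have := AB _ _ yA xB; rewrite xy ltxx.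
  + exact: dB'.
- move/contiguousE: conA => conA; move/contiguousE: conB' => conB'.
  apply/contiguousE => Q eQ lQ; have [rQ sQ tQ] := eQ.
  have QA : {in A &, forall x y, Q x y}.
    by apply: conA => // x y xA yA; apply: lQ; rewrite in_fsetU ?xA ?yA.
  have QB : {in slide t @` B &, forall x y, Q x y}.
    by apply: conB' => // x y xA yA; apply: lQ; rewrite in_fsetU ?xA ?yA orbT.
  have bB' : slide t b \in slide t @` B by rewrite in_imfset.
  have Qab : Q a (slide t b) by apply: lQ => //; rewrite in_fsetU ?aA ?bB' ?orbT.
  have base x : x \in A `|` slide t @` B -> Q x a.
    rewrite in_fsetU => /orP[xA|xB]; first exact: QA.
    by apply: tQ (QB _ _ xB bB') _; exact: sQ.
  by move=> x y /base xa /base ya; exact: tQ xa (sQ _ _ ya).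
- rewrite cardfsU nA nB'.
  have -> : A `&` slide t @` B = fset0.
    by apply/eqP/fset0Pn => -[x]; rewrite in_fsetI => /andP[xA xB]; have := AB _ _ xA xB; rewrite ltxx.
  by rewrite cardfs0 subn0.
Qed.

(* The lower part is recovered from the stack as its lowest blocks, whose number is known. *)
Lemma identified_cut A B A' B' : below A B -> below A' B' -> #|` A| = #|` A'| ->
  identified R (A `|` B) (A' `|` B') -> identified R A A' /\ identified R B B'.
Proof.
move=> AB A'B' cardA [f mf m]; have [k [v fE]] := motion_form mf.
have /choice[h hP] : forall b, exists c, b \in A `|` B -> c \in A' `|` B' /\ moved f b c.
  move=> b; have [bC|_] := boolP (b \in A `|` B); last by exists b.
  by have [c cC bc] := matches_fwd m bC; exists c.
have AC a : a \in A -> a \in A `|` B by rewrite in_fsetU => ->.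
have BC b : b \in B -> b \in A `|` B by rewrite in_fsetU => ->; rewrite orbT.
have hI : {in A `|` B &, injective h}.
  move=> b c /hP[_ bm] /hP[_ cm] E; rewrite E in bm; exact: moved_inv mf bm cm.
have hz : {in A `|` B &, forall b c, (block_z (h b) <= block_z (h c)) = (block_z b <= block_z c)}.
  move=> b c /hP[_ bm] /hP[_ cm].
  by rewrite -!(ler_int R) (moved_z fE bm) (moved_z fE cm) lerD2r.
have hS c : c \in A' `|` B' -> exists2 b, b \in A `|` B & c = h b.
  move=> /(matches_bwd m)[b bC bm]; exists b => //.
  by have [_ hm] := hP b bC; exact: moved_inj bm hm.
pose D := [fset h a | a in A].
have cardD : #|` D| = #|` A'|.
  rewrite -cardA card_in_imfset //= => a a' /AC aC /AC a'C; exact: hI.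
have DA' : D = A'.
  apply/eqP; rewrite eqEfcard cardD leqnn andbT; apply/fsubsetP => c cD.
  (* If a block of [A] landed in [B'], all of [A'] would lie below its image. Motions preserve the
     order of heights, so [A'] would come from [A] alone, and equal sizes would force [D = A'] after
     all. *)
  apply: contraT => cA'; have /imfsetP[a /= aA ca] := cD.
  have [hC _] := hP a (AC a aA).
  have hB' : c \in B' by move: hC; rewrite -ca in_fsetU (negPf cA').
  have sub : A' `<=` D.
    apply/fsubsetP => y yA'; have [|b bC yb] := hS y; first by rewrite in_fsetU yA'.
    rewrite yb; apply/imfsetP; exists b => //=; move: (bC); rewrite in_fsetU => /orP[//|bB].
    have := A'B' _ _ yA' hB'; rewrite yb ca ltNge hz //; last exact: AC.
    by rewrite ltW // AB.
  have : D == A' by rewrite eq_sym eqEfcard sub cardD leqnn.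
  by move=> /eqP E; rewrite -E cD in cA'.
split; exists f => //; apply: (@matchesP R).
- move=> a aA; have [_ hm] := hP a (AC a aA); exists (h a) => //.
  by rewrite -DA' in_imfset.
- rewrite -DA' => _ /imfsetP[a /= aA ->]; exists a => //.
  by have [] := hP a (AC a aA).
- move=> b bB; have [hC hm] := hP b (BC b bB); exists (h b) => //.
  move: hC; rewrite in_fsetU -DA' => /orP[/imfsetP[a /= aA]|//].
  move=> /(hI _ _ (BC b bB) (AC a aA)) E; have := AB _ _ aA bB.
  by rewrite E ltxx.
- move=> c cB'; have [|b bC cb] := hS c; first by rewrite in_fsetU cB' orbT.
  have [_ hm] := hP b bC; exists b; last by rewrite cb.
  move: (bC); rewrite in_fsetU => /orP[bA|//].
  have cA' : c \in A' by rewrite -DA' cb in_imfset.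
  by have := A'B' _ _ cA' cB'; rewrite ltxx.
Qed.

Lemma T24_super n m : (T24 R n.+1 * T24 R m.+1 <= T24 R (n.+1 + m.+1))%N.
Proof.
pose cs k := fset_set (building_classes R k.+1).
have /choice[r rP] : forall kc : nat * set {fset block}, exists B, kc.2 \in cs kc.1 ->
    contiguous_buildings R kc.1.+1 B /\ building_class R kc.1.+1 B = kc.2.
  move=> [k c]; have [ck|_] := boolP (c \in cs k); last by exists fset0.
  by have [B cB BE] := building_class_rep ck; exists B.
have /choice[st stP] : forall AB : {fset block} * {fset block}, exists B',
    contiguous_buildings R n.+1 AB.1 -> contiguous_buildings R m.+1 AB.2 ->
    [/\ identified R AB.2 B', below AB.1 B' & contiguous_buildings R (n.+1 + m.+1) (AB.1 `|` B')].
  move=> [A B]; have [[cA cB]|no] :=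
    pselect (contiguous_buildings R n.+1 A /\ contiguous_buildings R m.+1 B).
    by have [B' ?] := stack cA cB; exists B'.
  by exists fset0 => /= cA cB; case: no.
pose g (p : set {fset block} * set {fset block}) :=
  let A := r (n, p.1) in building_class R (n.+1 + m.+1) (A `|` st (A, r (m, p.2))).
have -> : (T24 R n.+1 * T24 R m.+1)%N = size [seq g (c, c') | c <- cs n, c' <- cs m].
  by rewrite size_allpairs.
apply: uniq_leq_size; last first.
  move=> _ /allpairsP[[c c'] /= [cn c'm ->]].
  have [cA _] := rP (n, c) cn; have [cB _] := rP (m, c') c'm.
  by have [_ _ cC] := stP (_, _) cA cB; exact: (@building_class_in (n + m.+1)).
apply: allpairs_uniq; rewrite ?fset_uniq //.
move=> p q /allpairsP[[c c'] /= [cn c'm ->]] /allpairsP[[d d'] /= [dn d'm ->]].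
rewrite /g /=.
have [cA A1] := rP (n, c) cn; have [cB B1] := rP (m, c') c'm.
have [cA2 A2] := rP (n, d) dn; have [cB2 B2] := rP (m, d') d'm.
have [iB AB cC] := stP (_, _) cA cB; have [iB2 AB2 cC2] := stP (_, _) cA2 cB2.
move=> /(identified_of_class cC2) /identified_cut [] //.
  by have [_ _ ->] := cA; have [_ _ ->] := cA2.
move=> IA IB; congr (_, _).
  by rewrite -[LHS]A1 -[RHS]A2; exact: class_of_identified.
rewrite -[LHS]B1 -[RHS]B2; apply: class_of_identified.
exact: identified_trans (identified_trans iB IB) (identified_sym iB2).
Qed.

Lemma T24_gt0 n : (0 < T24 R n.+1)%N.
Proof.
have [L gL] : exists L, good true [fset ((false, 0, 0) : blk)] n L.
  elim: n => [|n [L [gL vL sL]]].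
    exists [::]; split => //; last by rewrite big_nil.
    exact: glue_nil.
  exists ([fset ((false, 0, 0) : blk)] :: L); split.
  - apply: (@glue_up _ true _ _ [fset ((false, 0, 0) : blk)]) gL => //.
      by exists (false, 0, 0); rewrite inE.
    move=> k Q [rQ _ _] adjQ _; split.
    + by move=> _ x y /fset1P-> /fset1P->.
    + by move=> x xD; exists x.
    + by move=> s sS; exists s => //; apply: adjQ => //; exact: overlap_refl.
  - move=> D; rewrite inE => /predU1P[->|/vL//]; split; last by rewrite -cardfs_gt0 cardfs1.
    by move=> x y /fset1P-> /fset1P->.
  - by rewrite big_cons sL cardfs1.
have := @T24_towers (false, 0, 0) n [:: L] isT.
have h : forall L0, L0 \in [:: L] -> good true [fset ((false, 0, 0) : blk)] n L0.
  by move=> L0; rewrite inE => /eqP->.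
by move=> /(_ h); case: (T24 R n.+1).
Qed.
End Super.

(** * The limit *)

Section Fekete.
Local Open Scope classical_set_scope.
Local Open Scope ring_scope.
Variables (R : realType) (u : nat -> R) (C : R).
Hypothesis u_super : forall n m, (0 < n)%N -> (0 < m)%N -> u n + u m <= u (n + m)%N.
Hypothesis u_ge0 : forall n, (0 < n)%N -> 0 <= u n.
Hypothesis u_le : forall n, (0 < n)%N -> u n / n%:R <= C.

Lemma super_mul q m r : (0 < m)%N -> (0 < r)%N -> q%:R * u m <= u (q * m + r)%N.
Proof.
move=> m0 r0; elim: q => [|q IH]; first by rewrite mul0r mul0n u_ge0.
rewrite mulSn -addnA -natr1 mulrDl mul1r addrC; apply: le_trans (u_super m0 _).
  by rewrite lerD2l.
by rewrite addn_gt0 r0 orbT.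
Qed.

Let S := [set u n / n%:R | n in [set n | (0 < n)%N]].

Lemma sup_slopes : has_sup S.
Proof.
split; first by exists (u 1 / 1%:R), 1%N.
by exists C => _ [n n0 <-]; exact: u_le.
Qed.

Lemma fekete : (fun n => u n / n%:R) @ \oo --> sup S.
Proof.
apply/cvgrPdist_le => e e0.
have [_ [m m0 <-] um] := sup_adherent (divr_gt0 e0 (ltr0n _ 2)) sup_slopes.
have mR : 0 < m%:R :> R by rewrite ltr0n.
near=> n.
have n0 : (0 < n)%N by near: n; exact: nbhs_infty_gt.
have nR : 0 < n%:R :> R by rewrite ltr0n.
have un : u n / n%:R <= sup S by apply: ub_le_sup; [exact: (proj2 sup_slopes)|exists n].
rewrite ger0_norm ?subr_ge0 // lerBlDr.
(* The remainder is taken between 1 and [m], since the hypotheses on [u] concern positive indices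
   only. *)
pose q := (n.-1 %/ m)%N; pose r := (n.-1 %% m).+1.
have nE : n = (q * m + r)%N by rewrite /r addnS -divn_eq prednK.
have qmu : q%:R * u m <= u n by rewrite [in leRHS]nE; exact: super_mul.
have qm : n%:R - m%:R <= q%:R * m%:R :> R.
  by rewrite lerBlDr -natrM -natrD ler_nat nE leq_add2l /r ltn_mod.
have slope : (n%:R - m%:R) * (u m / m%:R) <= u n.
  apply: le_trans qmu; have -> : q%:R * u m = q%:R * m%:R * (u m / m%:R) by field; rewrite gt_eqF.
  by rewrite ler_wpM2r // divr_ge0 ?u_ge0 // ltW.
have C0 : 0 <= C by apply: le_trans (u_le m0); rewrite divr_ge0 ?u_ge0 // ltW.
(* The incomplete last stretch of length at most [m] lowers the slope by at most [m C / n], which is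
   below [e / 2] for large [n]. *)
have small : m%:R * C <= e / 2 * n%:R.
  have : m%:R * C / (e / 2) <= n%:R by near: n; exact: nbhs_infty_ger.
  by rewrite ler_pdivrMr ?divr_gt0 // (mulrC n%:R).
have : u m / m%:R - e / 2 <= u n / n%:R.
  rewrite ler_pdivlMr //; have muC : m%:R * (u m / m%:R) <= m%:R * C.
    by rewrite ler_wpM2l ?u_le // ltW.
  by move: slope small muC; set a := u m / m%:R; move: (u n) => b; nra.
move: um; set a := u m / m%:R; set b := u n / n%:R; lra.
Unshelve. all: by end_near.
Qed.

Lemma fekete_le m : (0 < m)%N -> u m / m%:R <= limn (fun n => u n / n%:R).
Proof.
move=> m0; rewrite (cvg_lim _ fekete) //.
by apply: ub_le_sup; [exact: (proj2 sup_slopes)|exists m].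
Qed.
End Fekete.

(** * Comparison of the growth rates *)

Section Conclusion.
Local Open Scope classical_set_scope.
Local Open Scope ring_scope.
Variable R : realType.
Notation T n := ((T24 R n)%:R : R).

Lemma T24_pos n : (0 < n)%N -> 1 <= T n.
Proof. by case: n => // n _; rewrite ler1n T24_gt0. Qed.

Lemma ln_T24_super n m : (0 < n)%N -> (0 < m)%N -> ln (T n) + ln (T m) <= ln (T (n + m)).
Proof.
move=> n0 m0; have [Tn Tm] := (lt_le_trans ltr01 (T24_pos n0), lt_le_trans ltr01 (T24_pos m0)).
rewrite -lnM // ler_ln ?posrE ?mulr_gt0 //; last first.
  by apply: lt_le_trans ltr01 _; apply: T24_pos; rewrite addn_gt0 n0.
case: n m n0 m0 {Tn Tm} => [//|n] [//|m] _ _; rewrite -natrM ler_nat.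
exact: T24_super.
Qed.

Lemma ln_T24_le n : (0 < n)%N -> ln (T n) / n%:R <= ln (2 * size steps ^ 2)%N%:R :> R.
Proof.
case: n => // n _.
have s0 : (0 < size steps)%N by rewrite /steps size_allpairs.
have K0 : (0 < 2 * size steps ^ 2)%N by rewrite muln_gt0 expn_gt0 s0.
rewrite ler_pdivrMr ?ltr0n // mulr_natr -lnXn ?ltr0n //.
rewrite ler_ln ?posrE ?ltr0n ?exprn_gt0 ?T24_gt0 ?ltr0n // -natrX ler_nat.
apply: leq_trans (T24_le R n) _; rewrite expnMn -expnM leq_mul //.
  by rewrite -{1}(expn1 2) leq_exp2l.
by rewrite leq_pexp2l // (mulnC n) leq_mul2l leqnSn orbT.
Qed.

Lemma rate_gt : 7832 / 100 < rate R.
Proof. by rewrite /rate ZtoR_cent ZtoR_mu; lra. Qed.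

Lemma T24_ge : exists2 c : R, 0 < c & forall n, (1 < n)%N -> c * rate R ^+ n <= T n.
Proof.
have rate0 := rate_gt0 R; have den0 := weight_den_gt0 R.
have V0 : 0 < ZtoR R Vsingle by apply: ZtoR_gt0.
(* The 4 pays for the rotations, and one factor [rate R] for the bottom block, which is not among
   the blocks counted by [claim]. *)
exists (ZtoR R Vsingle / (rate R ^+ 3 * ZtoR R Vmax) / (4 * rate R)).
  by apply: divr_gt0; [exact: divr_gt0|exact: mulr_gt0].
case=> [|n] // n1; have [c1 _ _] := @claim_all R n n1.
have [s [us sg sw]] := c1 (false, 0, 0).
have : (size s)%:R <= T n.+1 * 4.
  by rewrite -[4]/(4%:R) -natrM ler_nat; apply: T24_towers us sg.
move=> /(le_trans sw); rewrite /weight (exprS _ n).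
move: (ZtoR R Vsingle) (rate R ^+ 3 * ZtoR R Vmax) den0 => v d d0.
move: (T n.+1) (rate R) rate0 => t y y0 h.
move: (y ^+ n) h => x h.
rewrite [leLHS](_ : _ = v * (x / d) / 4); last by field; rewrite !gt_eqF.
by rewrite ler_pdivrMr.
Qed.

Lemma rate_le_h24 : rate R <= h24 R.
Proof.
have [c c0 cT] := T24_ge; have rate0 := rate_gt0 R.
rewrite /h24 -[rate R]lnK ?posrE // ler_expR.
set L := s24 R; have slope n : (0 < n)%N -> ln (T n) / n%:R <= L.
  have := @fekete_le R (fun n => ln (T n)) _ ln_T24_super _ ln_T24_le n; apply.
  by move=> k k0; rewrite ln_ge0 // T24_pos.
(* The bound [slope] holds for every [n], not only in the limit. A gap [d] between [L] and
   [ln (rate R)] would keep [n%:R * d] below the constant [- ln c], against the Archimedean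
   property. *)
rewrite leNgt; apply/negP => Lr.
pose d := ln (rate R) - L; have d0 : 0 < d by rewrite subr_gt0.
have le_nd n : (1 < n)%N -> n%:R * d <= - ln c.
  move=> n1; have n0 : 0 < n%:R :> R by rewrite ltr0n ltnW.
  have := slope n (ltnW n1); rewrite ler_pdivrMr // => TL.
  have : ln (c * rate R ^+ n) <= ln (T n).
    by rewrite ler_ln ?posrE ?cT // ?mulr_gt0 ?exprn_gt0 // (lt_le_trans ltr01) // T24_pos // ltnW.
  rewrite lnM ?posrE ?exprn_gt0 // lnXn // -[_ *+ n]mulr_natl /d => h.
  by rewrite mulrBr; lra.
pose N := (Num.truncn (`|- ln c / d|)).+2.
have := le_nd N isT; rewrite leNgt => /negP; apply.
rewrite -ltr_pdivrMr //; apply: le_lt_trans (ler_norm _) _.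
by apply: lt_trans (truncnS_gt _) _; rewrite ltr_nat.
Qed.
End Conclusion.

Theorem theorem4p1 (R : realType) : h24 R > 7832 / 100.
Proof. exact: lt_le_trans (rate_gt R) (rate_le_h24 R). Qed.
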